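(* Let $G$ be a finitely generated group. The following are equivalent: (a) $G$ embeds in the automorphism group of some uniformly bounded tree; (b) $G$ embeds in the automorphism group of some regular tree (of finite degree); (c) $G$ can be expressed as the fundamental group of a finite graph of groups (possibly trivial) with edge groups having finite index in the vertex groups and where every vertex group possesses an index $n$-chain for some $n$.
   Context: Trees are simplicial trees and automorphisms of a tree are simplicial automorphisms. A locally finite tree is uniformly bounded if there is a finite upper bound for the degrees of its vertices, and regular if all vertices have the same finite degree. A finite graph of groups has a finite connected underlying graph; it is allowed to be trivial, for instance a single vertex with vertex group $G$. For an integer $n\ge 2$, a group $H$ has an index $n$-chain if there is a descending sequence of finite index subgroups $H=H_0\ge H_1\ge H_2\ge\cdots$ with $\bigcap_{i=0}^{\infty}H_i=\{\mathrm{id}\}$ and $[H_i:H_{i+1}]\le n$ for all $i\ge 0$ (repetitions are allowed). *)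

(* Defs.v *)
From HB Require Import structures.
From mathcomp Require Import all_boot.
From mathcomp Require Import boolp classical_sets functions cardinality.

Set Implicit Arguments.
Unset Strict Implicit.
Unset Printing Implicit Defensive.

Local Open Scope group_scope.
Local Open Scope quotient_scope.
Local Open Scope classical_set_scope.
Local Open Scope card_scope.

Definition embeds (G H : groupType) : Prop :=
  exists f : {multiplicative G -> H}, injective f.

Definition isomorphic (G H : groupType) : Prop :=
  exists f : {multiplicative G -> H}, bijective f.

Definition subgroup (G : groupType) (K : set G) : Prop :=
  group_closed (fun x : G => x \in K).

Definition finitely_generated (G : groupType) : Prop :=
  exists S : seq G, forall K : set G,
    subgroup K -> [set` S] `<=` K -> K = [set: G].

Definition cosets (G : groupType) (H K : set G) : set (set G) :=
  [set [set x * k | k in K] | x in H].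

Definition finite_index (G : groupType) (H K : set G) : Prop :=
  finite_set (cosets H K).

Definition index_le (G : groupType) (H K : set G) (n : nat) : Prop :=
  cosets H K #<= `I_n.

Definition has_index_chain (H : groupType) (n : nat) : Prop :=
  exists K : nat -> set H,
    K 0%N = [set: H] /\
    (forall i, subgroup (K i)) /\
    (forall i, finite_index [set: H] (K i)) /\
    (forall i, K i.+1 `<=` K i) /\
    (forall i, index_le (K i) (K i.+1) n) /\
    \bigcap_(i in [set: nat]) K i = [set 1].

(* A simplicial tree is given by its 1-skeleton: a nonempty connected simple
   graph in which no simple cycle has length at least 3 (with [ucycle], an edge
   run through back and forth counts as a cycle of length 2). *)
Record tree := Tree {
  vertex :> choiceType;
  adj : rel vertex;
  adj_sym : symmetric adj;
  adj_irr : irreflexive adj;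
  tree_nonempty : inhabited vertex;
  tree_connected : forall x y : vertex,
    exists p : seq vertex, path adj x p /\ last x p = y;
  tree_acyclic : forall c : seq vertex, (2 < size c)%N -> ~ ucycle adj c
}.

Definition neighbours (T : tree) (x : T) : set T := [set y | adj x y].

Definition uniformly_bounded (T : tree) : Prop :=
  exists d : nat, forall x : T, neighbours x #<= `I_d.

Definition regular (T : tree) : Prop :=
  exists d : nat, forall x : T, neighbours x #= `I_d.

(* The inverse is uniquely determined by [aut_fun]; see [tree_aut_eq]. *)
Record tree_aut (T : tree) := TreeAut {
  aut_fun :> T -> T;
  aut_inv : T -> T;
  aut_funK : cancel aut_fun aut_inv;
  aut_invK : cancel aut_inv aut_fun;
  aut_adj : {mono aut_fun : x y / adj x y}
}.

Section TreeAutGroup.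
Variable T : tree.
Implicit Types f g h : tree_aut T.

Lemma tree_aut_eq f g : (f =1 g) -> f = g.
Proof.
case: f g => [f f' fK f'K fa] [g g' gK g'K ga] /= /funext fg; subst g.
have e : f' = g' by apply/funext => x; rewrite -[in LHS](g'K x) fK.
by subst g'; congr TreeAut; apply: Prop_irrelevance.
Qed.

Definition aut_one : tree_aut T :=
  @TreeAut T id id (fun=> erefl) (fun=> erefl) (fun _ _ => erefl).

Lemma aut_inv_adj f : {mono aut_inv f : x y / adj x y}.
Proof. by move=> x y; rewrite -(aut_adj f) !aut_invK. Qed.

Definition aut_opp f : tree_aut T :=
  TreeAut (aut_invK f) (aut_funK f) (@aut_inv_adj f).

Lemma aut_mul_adj f g : {mono f \o g : x y / adj x y}.
Proof. by move=> x y; rewrite /= !aut_adj. Qed.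

Definition aut_mul f g : tree_aut T :=
  TreeAut (can_comp (aut_funK f) (aut_funK g))
          (can_comp (aut_invK g) (aut_invK f)) (@aut_mul_adj f g).

Lemma aut_mulA : associative aut_mul.
Proof. by move=> f g h; apply: tree_aut_eq. Qed.
Lemma aut_mul1 : left_id aut_one aut_mul.
Proof. by move=> f; apply: tree_aut_eq. Qed.
Lemma aut_mulr1 : right_id aut_one aut_mul.
Proof. by move=> f; apply: tree_aut_eq. Qed.
Lemma aut_mulV : left_inverse aut_one aut_opp aut_mul.
Proof. by move=> f; apply: tree_aut_eq => x /=; rewrite aut_funK. Qed.
Lemma aut_mulrV : right_inverse aut_one aut_opp aut_mul.
Proof. by move=> f; apply: tree_aut_eq => x /=; rewrite aut_invK. Qed.

HB.instance Definition _ := gen_eqMixin (tree_aut T).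
HB.instance Definition _ := gen_choiceMixin (tree_aut T).
HB.instance Definition _ := isGroup.Build (tree_aut T)
  aut_mulA aut_mul1 aut_mulr1 aut_mulV aut_mulrV.
End TreeAutGroup.

(* Every geometric edge of the underlying multigraph (loops and multiple edges
   allowed) is listed once, with an arbitrary orientation. *)
Record graph_of_groups := GraphOfGroups {
  gvert : finType;
  gedge : finType;
  src : gedge -> gvert;
  tgt : gedge -> gvert;
  vgroup : gvert -> groupType;
  egroup : gedge -> groupType;
  to_src : forall e, {multiplicative egroup e -> vgroup (src e)};
  to_tgt : forall e, {multiplicative egroup e -> vgroup (tgt e)};
  to_src_inj : forall e, injective (to_src e);
  to_tgt_inj : forall e, injective (to_tgt e);
  gg_nonempty : inhabited gvert;
  gg_connected : forall u v,
    connect (fun a b => [exists e, ((src e == a) && (tgt e == b))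
                                || ((src e == b) && (tgt e == a))]) u v
}.

Definition finite_index_edges (Y : graph_of_groups) : Prop :=
  forall e : gedge Y,
    finite_index [set: vgroup (src e)] (range (to_src e)) /\
    finite_index [set: vgroup (tgt e)] (range (to_tgt e)).

Section FundamentalGroup.
Variable Y : graph_of_groups.

(* A letter is an element of a vertex group, or the stable letter t_e of an
   edge ([(e, true)], from [src e] to [tgt e]) or its inverse ([(e, false)]). *)
Definition letter : Type := ({v : gvert Y & vgroup v} + gedge Y * bool)%type.
HB.instance Definition _ := Choice.on letter.

Definition vlet (v : gvert Y) (x : vgroup v) : letter :=
  inl (Tagged (fun v => vgroup v) x).
Definition elet (e : gedge Y) (b : bool) : letter := inr (e, b).

Definition letter_src (a : letter) : gvert Y :=
  match a with
  | inl u => tag u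
  | inr (e, b) => if b then src e else tgt e
  end.

Definition letter_tgt (a : letter) : gvert Y :=
  match a with
  | inl u => tag u
  | inr (e, b) => if b then tgt e else src e
  end.

Definition letter_inv (a : letter) : letter :=
  match a with
  | inl u => vlet (tagged u)^-1
  | inr (e, b) => elet e (~~ b)
  end.

(* Equality of words in the path group F(Y): the quotient of the free product
   of the vertex groups and of the free group on the t_e by the relations
   t_e * to_tgt a * t_e^-1 = to_src a. *)
Inductive word_eq : seq letter -> seq letter -> Prop :=
| we_refl w : word_eq w w
| we_sym w w' : word_eq w w' -> word_eq w' w
| we_trans w w' w'' : word_eq w w' -> word_eq w' w'' -> word_eq w w''
| we_cat u u' w w' : word_eq u u' -> word_eq w w' -> word_eq (u ++ w) (u' ++ w')
| we_one v : word_eq [:: vlet (1 : vgroup v)] [::]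
| we_mul v (x y : vgroup v) : word_eq [:: vlet x; vlet y] [:: vlet (x * y)]
| we_inv e b : word_eq [:: elet e b; elet e (~~ b)] [::]
| we_edge e (a : egroup e) :
    word_eq [:: elet e true; vlet (to_tgt e a); elet e false]
            [:: vlet (to_src e a)].

Fixpoint walk (u v : gvert Y) (w : seq letter) : bool :=
  if w is a :: w' then (letter_src a == u) && walk (letter_tgt a) v w'
  else u == v.

Lemma walk_cat u v t w w' : walk u v w -> walk v t w' -> walk u t (w ++ w').
Proof.
elim: w u => [|a w IH] u /=; first by move/eqP->.
by case/andP=> -> /IH h /h.
Qed.

Definition winv (w : seq letter) : seq letter := rev (map letter_inv w).

Lemma winv_cons a w : winv (a :: w) = winv w ++ [:: letter_inv a].
Proof. by rewrite /winv /= rev_cons cats1. Qed.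

Lemma walk_winv u v w : walk u v w -> walk v u (winv w).
Proof.
elim: w u => [|a w IH] u; first by rewrite /= eq_sym.
case/andP=> /eqP <- /IH h; rewrite winv_cons; apply: walk_cat h _.
by case: a => [[x g]|[e []]] /=; rewrite !eqxx.
Qed.

Lemma letter_invK : involutive letter_inv.
Proof. by case=> [[x g]|[e b]]; rewrite /= /vlet /= ?invgK // /elet negbK. Qed.

Lemma winvK : involutive winv.
Proof.
move=> w; rewrite /winv map_rev revK -map_comp map_id_in // => a _ /=.
by rewrite letter_invK.
Qed.

Lemma letterV a : word_eq [:: a; letter_inv a] [::].
Proof.
case: a => [[x g]|[e b]]; last exact: we_inv.
by apply: we_trans (we_mul _ _) _; rewrite mulgV; apply: we_one.
Qed.

Lemma winvV w : word_eq (w ++ winv w) [::].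
Proof.
elim: w => [|a w IH]; first exact: we_refl.
rewrite winv_cons -cat1s -catA [w ++ _]catA.
apply: we_trans (letterV a); apply: (@we_cat [:: a] _ _ _ (we_refl _)).
exact: (we_cat IH (we_refl _)).
Qed.

Lemma winv_eq w w' : word_eq w w' -> word_eq (winv w) (winv w').
Proof.
move=> ww'.
apply: (@we_trans _ (winv w ++ (w' ++ winv w'))).
  rewrite -[X in word_eq X]cats0.
  exact: we_cat (we_refl _) (we_sym (winvV _)).
apply: (@we_trans _ (winv w ++ (w ++ winv w'))).
  by apply: we_cat (we_refl _) _; apply: we_cat (we_sym ww') (we_refl _).
rewrite catA; apply: we_cat (_ : word_eq _ [::]) (we_refl _).
by rewrite -{2}[w]winvK; apply: winvV.
Qed.

Variable v0 : gvert Y.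

Definition loop : Type := {w : seq letter | walk v0 v0 w}.
HB.instance Definition _ := Choice.on loop.

Definition loop_eq : rel loop := fun p q => `[< word_eq (val p) (val q) >].

Lemma loop_eq_refl : reflexive loop_eq.
Proof. by move=> p; apply/asboolP; apply: we_refl. Qed.
Lemma loop_eq_sym : symmetric loop_eq.
Proof. by move=> p q; apply/asboolP/asboolP; apply: we_sym. Qed.
Lemma loop_eq_trans : transitive loop_eq.
Proof.
by move=> q p r /asboolP h /asboolP k; apply/asboolP; apply: we_trans h k.
Qed.

Canonical loop_equiv :=
  EquivRel loop_eq loop_eq_refl loop_eq_sym loop_eq_trans.

(* The subgroup of F(Y) of the elements represented by loops at v0. *)
Definition pi1 : Type := {eq_quot loop_equiv}.
HB.instance Definition _ := Choice.on pi1.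
HB.instance Definition _ := EqQuotient.on pi1.

Definition loop_one : loop := exist _ [::] (eqxx v0).
Definition loop_mul (p q : loop) : loop :=
  exist _ (val p ++ val q) (walk_cat (valP p) (valP q)).
Definition loop_inv (p : loop) : loop :=
  exist _ (winv (val p)) (walk_winv (valP p)).

Definition pi1_one : pi1 := \pi_pi1 loop_one.
Definition pi1_mul (p q : pi1) : pi1 := \pi_pi1 (loop_mul (repr p) (repr q)).
Definition pi1_inv (p : pi1) : pi1 := \pi_pi1 (loop_inv (repr p)).

Lemma pi1P (p q : loop) : \pi_pi1 p = \pi_pi1 q <-> word_eq (val p) (val q).
Proof.
split=> [/eqmodP/asboolP //|h].
by apply/eqmodP/asboolP.
Qed.

Lemma pi1_reprP (p : loop) : word_eq (val (repr (\pi_pi1 p))) (val p).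
Proof. by apply/pi1P; rewrite reprK. Qed.

Lemma pi1_mulE (p q : loop) :
  pi1_mul (\pi_pi1 p) (\pi_pi1 q) = \pi_pi1 (loop_mul p q).
Proof. by apply/pi1P; apply: we_cat; apply: pi1_reprP. Qed.

Lemma pi1_invE (p : loop) : pi1_inv (\pi_pi1 p) = \pi_pi1 (loop_inv p).
Proof. by apply/pi1P; apply: winv_eq; apply: pi1_reprP. Qed.

Lemma pi1_mulA : associative pi1_mul.
Proof.
elim/quotW=> p; elim/quotW=> q; elim/quotW=> r.
rewrite (pi1_mulE q r) (pi1_mulE p q) (pi1_mulE p) (pi1_mulE (loop_mul p q)).
by congr (\pi_pi1 _); apply: val_inj; rewrite /= catA.
Qed.
Lemma pi1_mul1 : left_id pi1_one pi1_mul.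
Proof.
by elim/quotW=> p; rewrite (pi1_mulE loop_one p);
  congr (\pi_pi1 _); apply: val_inj.
Qed.
Lemma pi1_mulr1 : right_id pi1_one pi1_mul.
Proof.
by elim/quotW=> p; rewrite (pi1_mulE p loop_one);
  congr (\pi_pi1 _); apply: val_inj; rewrite /= cats0.
Qed.
Lemma pi1_mulrV : right_inverse pi1_one pi1_inv pi1_mul.
Proof.
by elim/quotW=> p; rewrite pi1_invE (pi1_mulE p (loop_inv p));
  apply/pi1P; apply: winvV.
Qed.
Lemma pi1_mulV : left_inverse pi1_one pi1_inv pi1_mul.
Proof.
elim/quotW=> p; rewrite pi1_invE (pi1_mulE (loop_inv p) p).
apply/pi1P => /=.
by rewrite -{2}[val p]winvK; apply: winvV.
Qed.

HB.instance Definition _ := isGroup.Build pi1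
  pi1_mulA pi1_mul1 pi1_mulr1 pi1_mulV pi1_mulrV.
End FundamentalGroup.

(* Main.v *)
(** (a) => (b): glue rooted (d-1)-ary hairs at every vertex of degree less than d,
    in an equivariant way.

    (c) => (a): G acts on the Bass-Serre tree of Y, which is uniformly bounded as
    the edge groups have finite index.  If H_0 >= H_1 >= ... is an index n-chain
    of the vertex group at v0, glue to the vertices of the orbit of the base
    vertex the coset trees with vertices g H_i: this increases degrees by at most
    n, and the action becomes faithful as the H_i intersect trivially.

    (b) => (c): after subdividing T, let F be a finite set of vertices containing
    paths from a base vertex to its images under generators of G.  The orbits of
    the vertices and edges of F form a finite graph of groups Y with a natural
    morphism pi_1(Y) -> G.  It is onto by the choice of F, and injective since a
    reduced word moves the base vertex away from itself.  A vertex stabiliser has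
    an index chain because T can be enumerated so that every vertex is adjacent
    to an earlier one. *)

Require Import Defs.
From HB Require Import structures.
From mathcomp Require Import all_boot.
From mathcomp Require Import boolp classical_sets functions cardinality.
From mathcomp Require Import zify.

Set Implicit Arguments.
Unset Strict Implicit.
Unset Printing Implicit Defensive.

Local Open Scope group_scope.
Local Open Scope quotient_scope.
Local Open Scope classical_set_scope.
Local Open Scope card_scope.

(** * Subgroups and indices *)

(** Trees are handled through heights instead of geodesics. A graph is acyclic as soon as no edge
    above height 0 is level, no vertex has two lower neighbours, and height 0 carries no cycle; the
    distance from a root in a given tree has these properties in turn. Both extensions, by hairs and
    by coset trees, are instances of one gluing construction.

    The obstacle for the Bass-Serre tree is that a vertex group must embed in the fundamental group,
    which needs a normal form theorem. Placing all vertex groups in one product removes the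
    composability conditions on words, so the theorem is proved for arbitrary words and specialised
    to walks afterwards.

    The converse construction does without normal forms: the height of the moving base point tells
    whether a word can be shortened. Subdivision supplies an invariant 2-colouring, which orients
    the edges and puts each edge stabiliser inside the stabilisers of both ends. The price is that
    some vertex groups stabilise the midpoint of an edge of T and may swap its ends, which affects
    only the first step of their chains. *)

Lemma card_le_seqP (T : choiceType) (A : set T) n :
  A #<= `I_n <-> exists2 s : seq T, (size s <= n)%N & A `<=` [set` s].
Proof.
split=> [An|[s sn As]]; last first.
  apply: (@card_le_trans _ _ _ `I_(size s)); last by rewrite card_le_II.
  apply: card_le_trans (subset_card_le As) _.
  apply/pcard_leP/injfunPex => /=; exists (index^~ s) => [x /=|x y].
    by rewrite index_mem.
  rewrite !inE /= => xs ys e; by rewrite -(nth_index x xs) e nth_index.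
have /finite_seqP[s As] : finite_set A by apply/finite_set_leP; exists n.
move/pcard_leP/injfunPex: An => /= [f fA fi].
exists (undup s); last by rewrite As => x /=; rewrite mem_undup.
rewrite -(size_map f) -[n in (_ <= n)%N](size_iota 0); apply: uniq_leq_size.
  rewrite map_inj_in_uniq ?undup_uniq// => x y.
  by rewrite !mem_undup => xs ys; apply: fi; rewrite As inE.
move=> _ /mapP[x xs ->]; rewrite mem_iota add0n /=.
by apply: fA; rewrite As /=; rewrite mem_undup in xs.
Qed.

Lemma card_le_inj (V : Type) (T : choiceType) (f : V -> T) (A : set V) n (s : seq T) :
  injective f -> (size s <= n)%N -> (forall y, A y -> f y \in s) -> A #<= `I_n.
Proof.
move=> fI sn As; have /card_eqPle[_ Af] := inj_card_eq (in2W fI : {in A &, injective f}).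
apply: card_le_trans Af _; apply/card_le_seqP; exists s => // _ [y Ay <-].
exact: As.
Qed.

Definition gnorm (G : groupType) :=
  (fun x y z : G => esym (mulgA x y z), @invgM G, @invgK G, @invg1 G,
   @mulKg G, @mulVKg G, @mulVg G, @mulgV G, @mul1g G, @mulg1 G).

Section Subgroups.
Variable G : groupType.
Implicit Types (K L H : set G) (x y : G).

Lemma subgroup1 K : subgroup K -> K 1.
Proof. by case=> h _; apply: set_mem h. Qed.

Lemma subgroupM K x y : subgroup K -> K x -> K y -> K (x * y).
Proof. by move/group_closedM => h Kx Ky; apply: set_mem; apply: h; rewrite inE. Qed.

Lemma subgroupV K x : subgroup K -> K x -> K x^-1.
Proof. by move/group_closedV => h Kx; apply: set_mem; apply: h; rewrite inE. Qed.

Lemma subgroupI K :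
  K 1 -> (forall x y, K x -> K y -> K (x * y)) -> (forall x, K x -> K x^-1) ->
  subgroup K.
Proof.
move=> K1 KM KV; split=> [|x y]; rewrite !inE // => Kx Ky.
by apply: KM => //; apply: KV.
Qed.

Definition lcoset x K : set G := [set x * k | k in K].

Lemma lcosetP K x y : lcoset x K y <-> K (x^-1 * y).
Proof.
split=> [[k Kk <-]|Kxy]; first by rewrite mulKg.
by exists (x^-1 * y) => //; rewrite mulVKg.
Qed.

Lemma lcoset_refl K x : subgroup K -> lcoset x K x.
Proof. by move=> /subgroup1 ?; apply/lcosetP; rewrite mulVg. Qed.

Lemma lcoset_eqP K x y : subgroup K -> lcoset x K = lcoset y K <-> K (x^-1 * y).
Proof.
move=> sK; split=> [e|Kxy].
  by apply/lcosetP; rewrite e; exact: lcoset_refl.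
have Kyx := subgroupV sK Kxy.
apply/predeqP => z; split=> /lcosetP h; apply/lcosetP.
  have -> : y^-1 * z = (x^-1 * y)^-1 * (x^-1 * z) by rewrite !gnorm.
  exact: subgroupM.
have -> : x^-1 * z = (x^-1 * y) * (y^-1 * z) by rewrite !gnorm.
exact: subgroupM.
Qed.

Lemma lcosetM K x y :
  subgroup K -> [set x * z | z in lcoset y K] = lcoset (x * y) K.
Proof.
move=> sK; apply/predeqP => z; split=> [[_ [k Kk <-] <-]|[k Kk <-]].
  by exists k; rewrite ?mulgA.
by exists (y * k); rewrite ?mulgA //; exists k.
Qed.

(** Orbit-stabiliser counting: a coset is recovered from the value of [phi] at any element of [H]
    that represents it. *)
Lemma index_le_orbit (X : choiceType) (phi : G -> X) (s : set X) H K n :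
  subgroup K -> (forall x y, H x -> H y -> phi x = phi y -> K (x^-1 * y)) ->
  (forall x, H x -> s (phi x)) -> s #<= `I_n -> index_le H K n.
Proof.
move=> sK phiK Hs /card_le_seqP[l ln sl]; apply/card_le_seqP.
pose f z := lcoset (xget 1 [set x | H x /\ phi x = z]) K.
exists (map f l) => [|C [x Hx <-]]; first by rewrite size_map.
apply/mapP; exists (phi x); first by apply: sl; apply: Hs.
rewrite /f; case: xgetP => [y _ [Hy yx]|/(_ x)[]//].
by apply/lcoset_eqP => //; apply: phiK.
Qed.

Lemma finite_index_trans H K L :
  subgroup K -> subgroup L -> finite_index H K -> finite_index K L ->
  finite_index H L.
Proof.
move=> sK sL /finite_seqP[s Hs] /finite_seqP[t Kt].
apply/finite_set_leP; exists (size [seq [set xget 1 A * z | z in B] | A <- s, B <- t]).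
apply/card_le_seqP; eexists; first exact: leqnn.
move=> C [x Hx <-]; apply/allpairsP => /=.
pose r := xget 1 (lcoset x K); have rx : lcoset x K r.
  by apply: xgetI; apply: lcoset_refl.
have Krx : K (r^-1 * x).
  by move/lcosetP: rx => /(subgroupV sK); rewrite invgM invgK.
exists (lcoset x K, lcoset (r^-1 * x) L); split=> /=.
- suff : [set` s] (lcoset x K) by []. by rewrite -Hs; exists x.
- suff : [set` t] (lcoset (r^-1 * x) L) by []. by rewrite -Kt; exists (r^-1 * x).
- by rewrite lcosetM // mulVKg.
Qed.
End Subgroups.

Section Multiplicative.
Variables (G H : groupType) (f : {multiplicative G -> H}).

Lemma morph1 : f 1 = 1.
Proof. by apply: (mulgI (f 1)); rewrite -gmulfM !mulg1. Qed.

Lemma morphV x : f x^-1 = (f x)^-1.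
Proof. by apply: (mulgI (f x)); rewrite -gmulfM !mulgV morph1. Qed.

Lemma subgroup_image (K : set G) : subgroup K -> subgroup (f @` K).
Proof.
move=> sK; apply: subgroupI => [|_ _ [x Kx <-] [y Ky <-]|_ [x Kx <-]].
- by exists 1; [exact: subgroup1|exact: morph1].
- by exists (x * y); [exact: subgroupM|exact: gmulfM].
- by exists x^-1; [exact: subgroupV|exact: morphV].
Qed.

Lemma index_le_image (K L : set G) n :
  index_le K L n -> index_le (f @` K) (f @` L) n.
Proof.
move=> /card_le_seqP[s sn KLs]; apply/card_le_seqP.
exists [seq f @` C | C <- s] => [|_ [_ [x Kx <-] <-]]; first by rewrite size_map.
apply/mapP; exists (lcoset x L); first by apply: KLs; exists x.
apply/predeqP => z; split=> [[_ [y Ly <-] <-]|[_ [y Ly <-] <-]].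
  by exists (x * y); [exists y|exact: gmulfM].
by exists (f y); [exists y|rewrite gmulfM].
Qed.
End Multiplicative.

Section SubgroupType.
Variables (G : groupType) (K : set G).
Hypothesis sK : subgroup K.

(** The vacuous [let] keeps [sK] among the parameters of the type, where the group instance finds
    it. *)
Definition subgroup_type : Type := let _ := sK in {x : G | x \in K}.
HB.instance Definition _ := SubChoice.on subgroup_type.
HB.instance Definition _ := SubChoice_isSubGroup.Build G _ subgroup_type sK.
End SubgroupType.

(** * Depth in a tree *)

Lemma seq_argmax (V : eqType) (h : V -> nat) (s : seq V) :
  s != [::] -> exists2 x, x \in s & forall y, y \in s -> (h y <= h x)%N.
Proof.
elim: s => // x s IH _; have [->|/IH[y ys hy]] := eqVneq s [::].
  by exists x => [|y]; rewrite inE // => /eqP->.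
have [xy|yx] := leqP (h x) (h y).
  by exists y => [|z]; rewrite inE ?ys ?orbT // => /predU1P[->|/hy].
exists x => [|z]; rewrite inE ?eqxx // => /predU1P[->//|/hy /leq_trans -> //].
exact: ltnW.
Qed.

(* At a vertex of maximal height both neighbours along a cycle would be its
   unique lower neighbour. *)
Lemma acyclic_height (V : eqType) (adj : rel V) (h : V -> nat) :
  symmetric adj ->
  (forall x y, adj x y -> (0 < h x)%N -> h x != h y) ->
  (forall x y z, adj x y -> adj x z -> (h y < h x)%N -> (h z < h x)%N -> y = z) ->
  (forall c, (2 < size c)%N -> all (fun x => h x == 0%N) c -> ~ ucycle adj c) ->
  forall c, (2 < size c)%N -> ~ ucycle adj c.
Proof.
move=> adjC hN hU h0 c c2 cyc.
have [|x xc xmax] := @seq_argmax _ h c; first by case: c c2 {cyc}.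
have [hx0|hx] := posnP (h x).
  by apply: (h0 c) => //; apply/allP => y /xmax; rewrite hx0 leqn0.
have [i p ep] := rot_to xc.
move: (cyc) c2; rewrite -(rot_ucycle i) -(size_rot i) ep => {}cyc.
have hlt y : y \in c -> adj x y -> (h y < h x)%N.
  by move=> yc xy; rewrite ltn_neqAle xmax // andbT eq_sym hN.
have pc y : y \in p -> y \in c.
  by move=> yp; rewrite -(mem_rot i) ep inE yp orbT.
case: p ep cyc pc => // y; case/lastP => // q z _ /andP[cyc u] pc _.
move: cyc; rewrite /= rcons_path last_rcons => /and3P[xy _ zx].
rewrite adjC in zx.
have yz : y = z.
  by apply: (hU x) => //; apply: hlt => //; apply: pc;
    rewrite inE ?eqxx // mem_rcons inE eqxx orbT.
by case/and3P: u => _; rewrite yz mem_rcons mem_head.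
Qed.

Section Depth.
Variables (T : tree) (z : T).

Definition reachable_in (x : T) (n : nat) : bool :=
  `[< exists p, [/\ path (@adj T) z p, last z p = x & size p = n] >].

Lemma reachable_ex x : exists n, reachable_in x n.
Proof.
by have [p [? ?]] := tree_connected z x; exists (size p); apply/asboolP; exists p.
Qed.

Definition depth x := ex_minn (reachable_ex x).

Lemma depthP x :
  exists p, [/\ path (@adj T) z p, last z p = x & size p = depth x].
Proof. by rewrite /depth; case: ex_minnP => n /asboolP. Qed.

Lemma depth_le p : path (@adj T) z p -> (depth (last z p) <= size p)%N.
Proof.
by move=> zp; rewrite /depth; case: ex_minnP => n _; apply; apply/asboolP; exists p.
Qed.

Lemma depth_path p x :
  path (@adj T) z p -> x \in z :: p -> (depth x <= size p)%N.
Proof.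
move=> zp /splitPl xp; case: xp zp => p1 p2 <-.
by rewrite cat_path size_cat => /andP[/depth_le h _]; apply: leq_trans h (leq_addr _ _).
Qed.

Lemma depth_root : depth z = 0%N.
Proof. by apply/eqP; rewrite -leqn0 (@depth_le [::]). Qed.

Lemma depth_eq0 x : depth x = 0%N -> x = z.
Proof. by have [[|? ?] [_ <- <-]] := depthP x. Qed.

Lemma depth_adj x y : adj x y -> (depth y <= (depth x).+1)%N.
Proof.
move=> xy; have [p [zp px <-]] := depthP x.
rewrite -(size_rcons p y) -{1}(last_rcons z p y); apply: depth_le.
by rewrite rcons_path zp px.
Qed.

(** Otherwise a simple path from [y] to [y'] off [x] closes up through [x] to a cycle of length at
    least 3. *)
Lemma tree_path_avoid (x y y' : T) p :
  adj x y -> adj x y' -> path (@adj T) y p -> last y p = y' -> x \notin y :: p ->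
  y = y'.
Proof.
move=> xy xy' yp yy' xp; apply/eqP/negPn/negP => neq.
case/shortenP: yp yy' => q yq uq qp yy'.
apply: (@tree_acyclic T [:: x, y & q]).
  by case: q yy' {yq uq qp} => [/= e|//]; rewrite e eqxx in neq.
rewrite /ucycle /cycle rcons_path [path _ _ _]/= xy yq /= yy' adj_sym xy'.
rewrite -/(uniq (y :: q)) uq andbT; apply: contra xp.
by rewrite !inE => /orP[->//|/qp ->]; rewrite orbT.
Qed.

(** A shortest path to [y] works: if it met [x] before its end, [x] would be less deep than [y]. *)
Lemma depth_avoid x y :
  adj x y -> (depth y <= depth x)%N ->
  exists p, [/\ path (@adj T) z p, last z p = y & x \notin z :: p].
Proof.
move=> xy yx; have [p [zp py sp]] := depthP y.
exists p; split=> //; apply/negP => xp.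
case/lastP: p zp py sp xp => [|p w] zp py sp.
  by rewrite inE => /eqP xz; move: xy; rewrite -py /= xz adj_irr.
move: py sp zp; rewrite last_rcons size_rcons rcons_path => -> sp /andP[zp _].
rewrite -rcons_cons mem_rcons inE => /predU1P[e|/(depth_path zp)].
  by move: xy; rewrite e adj_irr.
by lia.
Qed.

(** Shortest paths from the two neighbours to the root avoid [x], so they join the neighbours off
    [x]. The inequalities are weak so that [depth_neq] can compare a neighbour of equal depth with
    the parent. *)
Lemma depth_le_uniq x y y' :
  adj x y -> adj x y' -> (depth y <= depth x)%N -> (depth y' <= depth x)%N ->
  y = y'.
Proof.
move=> xy xy' /(depth_avoid xy)[p [zp py xp]] /(depth_avoid xy')[q [zq qy xq]].
apply: (@tree_path_avoid x y y' (rev (belast z p) ++ q)) => //.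
- rewrite cat_path -{1}py rev_path (eq_path (e' := @adj T)) => [|a b].
    rewrite zp /=; have -> : last y (rev (belast z p)) = z.
      by case: p {zp xp} py => [<-//|a p _] /=; rewrite rev_cons last_rcons.
    exact: zq.
  exact: adj_sym.
- rewrite last_cat; have -> : last y (rev (belast z p)) = z.
    by case: p {zp xp} py => [<-//|a p _] /=; rewrite rev_cons last_rcons.
  exact: qy.
rewrite inE mem_cat mem_rev; apply/negP => /or3P[/eqP e|xb|xq'].
- by move: xy; rewrite e adj_irr.
- by move/negP: xp; apply; apply: mem_belast.
- by move: xq; rewrite inE xq' orbT.
Qed.

Lemma depth_parent x : x != z -> exists2 y, adj x y & (depth y < depth x)%N.
Proof.
have [p [zp px <-]] := depthP x; case/lastP: p zp px => [_ /= ->|p w].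
  by rewrite eqxx.
rewrite rcons_path last_rcons size_rcons => /andP[zp h] <- _.
by exists (last z p); [rewrite adj_sym|rewrite ltnS depth_le].
Qed.

Lemma depth_neq x y : adj x y -> depth x <> depth y.
Proof.
move=> xy e; have [xz|/depth_parent[w xw wx]] := eqVneq x z.
  move: xy; rewrite xz in e *; rewrite depth_root in e.
  by rewrite (depth_eq0 (esym e)) adj_irr.
have wy : w = y by apply: (@depth_le_uniq x) => //; [exact: ltnW|rewrite e].
by rewrite wy e ltnn in wx.
Qed.

Lemma depth_step x y : adj x y -> depth y = (depth x).+1 \/ depth x = (depth y).+1.
Proof.
move=> xy; have := depth_adj xy; have yx := xy; rewrite adj_sym in yx.
have := depth_adj yx; have := depth_neq xy; lia.
Qed.
End Depth.

(** * Attaching vertices to a tree *)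

Section Connection.
Variables (V : Type) (e : rel V).
Hypothesis eC : symmetric e.

Definition joined x y := exists p, path e x p /\ last x p = y.

Lemma joined_refl x : joined x x.
Proof. by exists [::]. Qed.

Lemma joined_edge x y : e x y -> joined x y.
Proof. by move=> xy; exists [:: y]; rewrite /= xy. Qed.

Lemma joined_trans x y z : joined x y -> joined y z -> joined x z.
Proof.
move=> [p [xp py]] [q [yq qz]]; exists (p ++ q).
by rewrite cat_path last_cat py xp yq.
Qed.

Lemma joined_sym x y : joined x y -> joined y x.
Proof.
case=> p; elim: p x => [|w p IH] x /= [].
  by move=> _ ->; apply: joined_refl.
case/andP=> xw wp py; apply: joined_trans (IH w (conj wp py)) _.
by apply: joined_edge; rewrite eC.
Qed.
End Connection.

(** * Group actions on trees *)

Record tree_action (G : groupType) (T : tree) := TreeAction {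
  tact :> G -> T -> T;
  tact1 : forall x, tact 1 x = x;
  tactM : forall g h x, tact (g * h) x = tact g (tact h x);
  tact_adj : forall g x y, adj x y -> adj (tact g x) (tact g y)
}.

Section TreeActions.
Variables (G : groupType) (T : tree).

Lemma tactK (a : tree_action G T) g : cancel (a g) (a g^-1).
Proof. by move=> x; rewrite -tactM mulVg tact1. Qed.

Lemma tactVK (a : tree_action G T) g : cancel (a g^-1) (a g).
Proof. by move=> x; rewrite -tactM mulgV tact1. Qed.

Lemma tact_mono (a : tree_action G T) g : {mono a g : x y / adj x y}.
Proof.
move=> x y; apply/idP/idP; last exact: tact_adj.
by move/(tact_adj a g^-1); rewrite !tactK.
Qed.

Definition action_aut (a : tree_action G T) g : tree_aut T :=
  TreeAut (tactK a g) (tactVK a g) (tact_mono a g).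

Lemma faithful_embeds (a : tree_action G T) :
  (forall g, (forall x, a g x = x) -> g = 1) -> embeds G (tree_aut T).
Proof.
move=> fa.
have aM : {morph action_aut a : g h / g * h}.
  by move=> g h; apply: tree_aut_eq => x; exact: tactM.
pose m := @isMultiplicative.Build G (tree_aut T) (action_aut a) aM.
pose f : {multiplicative G -> tree_aut T} := HB.pack (action_aut a) m.
exists f => g h fgh; apply/eqP; rewrite -divg_eq1; apply/eqP/fa => x.
have : f g (a h^-1 x) = f h (a h^-1 x) by rewrite fgh.
by rewrite /= tactVK tactM.
Qed.

Lemma embeds_action :
  embeds G (tree_aut T) ->
  exists a : tree_action G T, forall g, (forall x, a g x = x) -> g = 1.
Proof.
case=> f fI.
have a1 x : f 1 x = x by rewrite morph1.
have aM g h x : f (g * h) x = f g (f h x) by rewrite gmulfM.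
have aA g x y : adj x y -> adj (f g x) (f g y) by rewrite aut_adj.
exists (TreeAction a1 aM aA) => g /= h; apply: fI; rewrite morph1.
exact: tree_aut_eq.
Qed.
End TreeActions.

(* The graph T + N in which every n : N is joined to its parent [par n]; the rank
   excludes circular parenthood. *)
Section Attach.
Variables (T : tree) (N : choiceType) (par : N -> T + N) (rk : N -> nat).
Hypothesis par_rk : forall n m, par n = inr m -> (rk m < rk n)%N.

Definition attach_adj (a b : T + N) : bool :=
  match a, b with
  | inl x, inl y => adj x y
  | inl x, inr n => par n == inl x
  | inr n, inl x => par n == inl x
  | inr n, inr m => (par n == inr m) || (par m == inr n)
  end.

Definition attach_height (a : T + N) : nat := if a is inr n then (rk n).+1 else 0.

Lemma attach_adj_sym : symmetric attach_adj.
Proof. by case=> [x|n] [y|m] //=; [exact: adj_sym|rewrite orbC]. Qed.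

Lemma par_neq n m : par n = inr m -> n <> m.
Proof. by move/par_rk => + nm; rewrite nm ltnn. Qed.

Lemma attach_adj_irr : irreflexive attach_adj.
Proof.
case=> [x|n] /=; first exact: adj_irr.
by rewrite orbb; apply/eqP => /par_neq.
Qed.

Lemma attach_lower n b :
  attach_adj (inr n) b -> (attach_height b < attach_height (inr n))%N ->
  b = par n.
Proof.
case: b => [x|m] /=; first by move/eqP.
case/orP => /eqP // /par_rk; rewrite ltnS; lia.
Qed.

Lemma attach_adj_par n : attach_adj (inr n) (par n).
Proof. by case E: (par n) => [x|m]; rewrite /= E eqxx. Qed.

Lemma attach_connected a b : exists p, path attach_adj a p /\ last a p = b.
Proof.
suff H c : exists x, joined attach_adj c (inl x).
  have [[x ax] [y bY]] := (H a, H b).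
  apply: (joined_trans ax); apply: joined_trans (joined_sym attach_adj_sym bY).
  have [p [xp <-]] := tree_connected x y; exists (map inl p).
  by rewrite last_map path_map.
case: c => [x|n]; first by exists x; exact: joined_refl.
have [k] := ubnP (rk n); elim: k n => // k IH n nk.
have nj := joined_edge (attach_adj_par n).
case E: (par n) nj => [x|m] nj; first by exists x.
have [|x mx] := IH m; first by have := par_rk E; lia.
by exists x; apply: joined_trans mx.
Qed.

Lemma attach_acyclic c : (2 < size c)%N -> ~ ucycle attach_adj c.
Proof.
move: c; apply: (acyclic_height (h := attach_height)).
- exact: attach_adj_sym.
- case=> [x|n] [y|m] //= h _; rewrite eqSS.
  by case/orP: h => /eqP /par_rk; lia.
- case=> [x|n] b c //.
  by move=> /attach_lower hb /attach_lower hc /hb -> /hc ->.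
move=> c c2 /allP c0.
(* At height 0 there are only vertices of T, so the cycle lies in T. *)
have [d ec] : exists d, c = map inl d.
  elim: c c0 {c2} => [|a c IH] c0; first by exists [::].
  have [|d ->] := IH; first by move=> y yc; apply: c0; rewrite inE yc orbT.
  by case: a c0 => [x|n] /(_ _ (mem_head _ _)) //= _; exists (x :: d).
rewrite /ucycle ec cycle_map map_inj_uniq; last by move=> ? ? [].
by move: c2; rewrite ec size_map => /tree_acyclic.
Qed.

Definition attach : tree :=
  Tree attach_adj_sym attach_adj_irr
    (let: inhabits x := tree_nonempty T in inhabits (inl x))
    attach_connected attach_acyclic.

Lemma attach_bounded k :
  uniformly_bounded T -> (forall a, [set n | par n = a] #<= `I_k) ->
  uniformly_bounded attach.
Proof.
case=> d Td Nk; exists (d + k).+1 => a.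
have /card_le_seqP[s sk Ns] := Nk a; apply/card_le_seqP.
case: a s sk Ns => [x|n] s sk Ns.
  have /card_le_seqP[t td xt] := Td x.
  exists (map inl t ++ map inr s) => [|[y|m] /=].
  - by rewrite size_cat !size_map; lia.
  - by move=> xy; rewrite mem_cat map_f //; apply: xt.
  by move=> /eqP px; rewrite mem_cat [X in _ || X]map_f ?orbT //; apply: Ns.
exists (par n :: map inr s) => [|b nb]; first by rewrite /= size_map; lia.
case: b nb => [y|m] /=; first by move=> /eqP ->; rewrite /= mem_head.
case/orP => /eqP pn; first by rewrite pn mem_head.
by rewrite inE [X in _ || X]map_f ?orbT //; apply: Ns.
Qed.

Section AttachAction.
Variables (G : groupType) (a : tree_action G T) (act : G -> N -> N).
Hypotheses (act1 : forall n, act 1 n = n)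
  (actM : forall g h n, act (g * h) n = act g (act h n)).

Definition attach_act g (b : T + N) : T + N :=
  match b with inl x => inl (a g x) | inr n => inr (act g n) end.

Hypothesis par_act : forall g n, par (act g n) = attach_act g (par n).

Lemma attach_act1 b : attach_act 1 b = b.
Proof. by case: b => [x|n] /=; rewrite ?tact1 ?act1. Qed.

Lemma attach_actM g h b : attach_act (g * h) b = attach_act g (attach_act h b).
Proof. by case: b => [x|n] /=; rewrite ?tactM ?actM. Qed.

Lemma attach_act_adj g b c :
  attach_adj b c -> attach_adj (attach_act g b) (attach_act g c).
Proof.
case: b c => [x|n] [y|m] /=; first exact: tact_adj.
- by move=> /eqP e; rewrite par_act e.
- by move=> /eqP e; rewrite par_act e.
by case/orP => /eqP e; rewrite !par_act e /= eqxx ?orbT.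
Qed.

Definition attach_action : tree_action G attach :=
  @TreeAction G attach attach_act attach_act1 attach_actM attach_act_adj.
End AttachAction.
End Attach.

(** * Gluing the coset trees of a chain of subgroups *)

Section ChainExtension.
Variables (G : groupType) (T : tree) (a : tree_action G T) (x0 : T).
Variables (L : nat -> set G) (k : nat).
Hypotheses (sL : forall i, subgroup (L i)) (L0 : forall g, L 0 g <-> a g x0 = x0)
  (LS : forall i, L i.+1 `<=` L i) (Lk : forall i, index_le (L i) (L i.+1) k)
  (Lcap : forall g, (forall i, L i g) -> g = 1).

(** The cosets of [L 0], the stabiliser of [x0], are already present as the orbit of [x0]. Level i
    therefore carries the cosets of [L i.+1]. *)
Definition chain_node : Type :=
  {c : nat * set G | `[< exists g, c.2 = lcoset g (L c.1.+1) >]}.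
HB.instance Definition _ := Choice.on chain_node.

Lemma node_subproof i g :
  `[< exists h, (i, lcoset g (L i.+1)).2 = lcoset h (L (i, lcoset g (L i.+1)).1.+1) >].
Proof. by apply/asboolP; exists g. Qed.

Definition node i g : chain_node := exist _ (i, lcoset g (L i.+1)) (node_subproof i g).

Lemma node_ind (P : chain_node -> Prop) : (forall i g, P (node i g)) -> forall n, P n.
Proof.
move=> H [[i C] nP]; have /asboolP[g /= e] := nP.
by have := H i g; congr P; apply: val_inj; rewrite /= e.
Qed.

Lemma node_eq i g h : node i g = node i h <-> L i.+1 (g^-1 * h).
Proof.
rewrite -lcoset_eqP //; split=> [e|e].
  by have /= [] := congr1 val e.
by apply: val_inj; rewrite /= e.
Qed.

Definition node_rep (n : chain_node) : G := xget 1 (val n).2.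

Lemma node_repP i g : L i.+1 (g^-1 * node_rep (node i g)).
Proof. by apply/lcosetP; apply: xgetI; apply: lcoset_refl. Qed.

Definition node_par (n : chain_node) : T + chain_node :=
  if (val n).1 is i.+1 then inr (node i (node_rep n)) else inl (a (node_rep n) x0).

Lemma node_parE i g :
  node_par (node i g) = if i is j.+1 then inr (node j g) else inl (a g x0).
Proof.
rewrite /node_par /=; have := node_repP i g; case: i => [|i] h.
  have /L0 := LS h; rewrite tactM => /(congr1 (a g)).
  by rewrite tactVK => ->.
by congr inr; apply/esym/node_eq/LS.
Qed.

Lemma node_par_rk n m : node_par n = inr m -> ((val m).1 < (val n).1)%N.
Proof.
by elim/node_ind: n => i g; rewrite node_parE; case: i => // i [<-] /=.
Qed.

(** This bounds the number of children: relative to one child, the others give cosets of [L i.+1] in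
    [L i]. *)
Lemma node_par_inj i j g h :
  node_par (node i g) = node_par (node j h) -> i = j /\ L i (g^-1 * h).
Proof.
rewrite !node_parE; case: i j => [|i] [|j] //.
  by move=> [e]; split=> //; apply/L0; rewrite tactM -e tactK.
by move=> [<-] e; split=> //; apply/lcoset_eqP.
Qed.

Definition node_act g (n : chain_node) : chain_node := node (val n).1 (g * node_rep n).

Lemma node_actE g i h : node_act g (node i h) = node i (g * h).
Proof. by apply/esym/node_eq; rewrite invgM -mulgA mulKg; apply: node_repP. Qed.

Lemma chain_extension :
  uniformly_bounded T ->
  exists T' : tree, uniformly_bounded T' /\ embeds G (tree_aut T').
Proof.
move=> Tb; have act1 n : node_act 1 n = n.
  by elim/node_ind: n => i g; rewrite node_actE mul1g.
have actM g h n : node_act (g * h) n = node_act g (node_act h n).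
  by elim/node_ind: n => i u; rewrite !node_actE mulgA.
have par_act g n : node_par (node_act g n) = attach_act a node_act g (node_par n).
  elim/node_ind: n => i u; rewrite node_actE !node_parE.
  by case: i => [|i] /=; rewrite ?tactM ?node_actE.
exists (attach node_par_rk); split.
  apply: (attach_bounded _ (k := k)) => // b.
  have [[n0 <-]|nob] := pselect (exists n, node_par n = b); last first.
    by apply/card_le_seqP; exists [::] => // n bn; case: nob; exists n.
  elim/node_ind: n0 => i g; have /card_le_seqP[s sk Ls] := Lk i.
  apply/card_le_seqP.
  exists [seq node i (g * xget 1 C) | C <- s]; first by rewrite size_map.
  elim/node_ind => j h /= /esym /node_par_inj[<-{j} Lgh].
  apply/mapP; exists (lcoset (g^-1 * h) (L i.+1)); first by apply: Ls; exists (g^-1 * h).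
  apply/node_eq; suff : lcoset (g^-1 * h) (L i.+1) (xget 1 (lcoset (g^-1 * h) (L i.+1))).
    by move/lcosetP; rewrite invgM invgK -!mulgA.
  by apply: xgetI; apply: lcoset_refl.
apply: (@faithful_embeds _ _ (attach_action node_par_rk act1 actM par_act)).
(* Fixing [node i 1] means lying in [L i.+1]; doing so for every i leaves only the identity. *)
move=> g gfix; apply: Lcap => i; apply: LS.
have := congr1 (fun b => if b is inr n then n else node i 1) (gfix (inr (node i 1))).
by rewrite /= node_actE mulg1 => /esym/node_eq; rewrite invg1 mul1g.
Qed.
End ChainExtension.

(** * Embedding in a regular tree *)

Section RegularExtension.
Variables (T : tree) (d : nat).
Hypothesis Td : forall x : T, neighbours x #<= `I_d.

Definition degree (x : T) : nat := xget 0 [set n | neighbours x #= `I_n].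

Lemma degreeP x : neighbours x #= `I_(degree x).
Proof.
have [n xn] : finite_set (neighbours x) by apply/finite_set_leP; exists d.
exact: (@xgetI _ 0%N [set n | _] n xn).
Qed.

Lemma degree_le x : (degree x <= d)%N.
Proof. by rewrite -card_le_II -(card_le_eql (degreeP x)). Qed.

(** Equivariance of the hairs rests on this: how many are glued at a vertex depends only on its
    degree. *)
Lemma degree_act (G : groupType) (a : tree_action G T) g x :
  degree (a g x) = degree x.
Proof.
have -> : degree x = xget 0 [set n | neighbours (a g x) #= `I_n]; last by [].
congr xget; apply/funext => n /=; congr is_true; apply: card_eql.
have -> : neighbours (a g x) = a g @` neighbours x.
  apply/predeqP => y; split=> [xy|[z xz <-]]; last exact: tact_adj.
  exists (a g^-1 y); last by rewrite tactVK.
  by rewrite /neighbours /= -(tact_mono a g) tactVK.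
by rewrite card_eq_sym inj_card_eq // => y z _ _ /(can_inj (tactK a g)).
Qed.

(** Words are read backwards: the last entry, the first step away from T, selects one of the [m]
    missing neighbours, and every other entry one of [d.-1] children. *)
Fixpoint hair_ok (m : nat) (w : seq nat) : bool :=
  match w with
  | [::] => false
  | [:: k] => (k < m)%N
  | k :: w' => (k < d.-1)%N && hair_ok m w'
  end.

(* [(x, w)] is the vertex at the end of the path [rev w] in the hair glued at
   [x]; its vertices other than [x] have d - 1 children. *)
Definition hair : Type :=
  {p : T * seq nat | hair_ok (d - degree p.1) p.2}.
HB.instance Definition _ := SubChoice.on hair.

Definition hair_root (n : hair) : T := (val n).1.
Definition hair_word (n : hair) : seq nat := (val n).2.
Arguments hair_root : simpl never.
Arguments hair_word : simpl never.

Lemma hair_eq n m : hair_root n = hair_root m -> hair_word n = hair_word m -> n = m.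
Proof.
by case: n m => -[x w] ? [[y v] ?]; rewrite /hair_root /hair_word /= => xy wv;
  apply: val_inj; rewrite /= xy wv.
Qed.

Lemma hair_wordP n : hair_ok (d - degree (hair_root n)) (hair_word n).
Proof. exact: (valP n). Qed.

(** [insub] fails exactly when the remaining word is empty, as [hair_ok] rejects the empty word. *)
Definition hair_par (n : hair) : T + hair :=
  if insub (hair_root n, behead (hair_word n)) is Some m then inr m
  else inl (hair_root n).

Lemma hair_exists x w :
  hair_ok (d - degree x) w -> exists n, hair_root n = x /\ hair_word n = w.
Proof. by move=> ok; exists (exist _ (x, w) ok). Qed.

Lemma hair_par_cons n m k :
  hair_root n = hair_root m -> hair_word n = k :: hair_word m -> hair_par n = inr m.
Proof.
rewrite /hair_par => -> -> /=; case: insubP => [p _ ep|/negP[]].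
  by congr inr; apply: hair_eq; rewrite /hair_root /hair_word ep.
exact: hair_wordP.
Qed.

Lemma hair_par_single n k : hair_word n = [:: k] -> hair_par n = inl (hair_root n).
Proof. by rewrite /hair_par => ->; rewrite insubN. Qed.

Variant hair_par_spec (n : hair) : T + hair -> Type :=
| HairRoot k of (k < d - degree (hair_root n))%N & hair_word n = [:: k] :
    hair_par_spec n (inl (hair_root n))
| HairStep (m : hair) k of (k < d.-1)%N & hair_root n = hair_root m
    & hair_word n = k :: hair_word m :
    hair_par_spec n (inr m).

Lemma hair_parP n : hair_par_spec n (hair_par n).
Proof.
have := hair_wordP n; case en: (hair_word n) => [//|k [|l w]] /= ok.
  by rewrite (hair_par_single en); apply: HairRoot en.
case/andP: ok => kd ok.
pose m : hair := exist _ (hair_root n, l :: w) ok.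
by rewrite (@hair_par_cons n m k) //; apply: (@HairStep _ m k).
Qed.

Lemma hair_par_rk n m : hair_par n = inr m -> (size (hair_word m) < size (hair_word n))%N.
Proof. by case: hair_parP => // p k _ _ -> [<-] /=. Qed.

(** Where a hair exists some degree falls short of d, so a parent and [d.-1] children do add up to
    d. *)
Lemma hair_gt0 (n : hair) : (0 < d)%N.
Proof.
have := hair_wordP n; elim: (hair_word n) => //= k [|l w] IH; first by lia.
by case/andP=> _ /IH.
Qed.

Definition regular_extension : tree := attach hair_par_rk.

Lemma regular_extension_regular : regular regular_extension.
Proof.
exists d; case=> [x|n].
  have /pcard_eqP/bijPex[f [fun_f inj_f surj_f]] := degreeP x.
  have dx := degree_le x.
  (* Neighbours in T take the numbers below the degree, first vertices of hairs the remaining ones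
     below d. *)
  pose g (b : T + hair) : nat :=
    match b with inl y => f y | inr n => (degree x + head 0%N (hair_word n))%N end.
  have nbrP n : hair_par n == inl x ->
      exists k, [/\ (k < d - degree x)%N, hair_root n = x & hair_word n = [:: k]].
    by case: hair_parP => // k kd en /eqP[<-]; exists k.
  apply/pcard_eqP/bijPex; exists g; rewrite /neighbours; split.
  - case=> [y|n] /=; first by move=> /fun_f /= h; apply: leq_trans h dx.
    by move=> /nbrP[k [kd _ ->]] /=; lia.
  - case=> [y|n] [z|m]; rewrite !inE /=.
    + by move=> xy xz /inj_f -> //; rewrite inE.
    + by move=> /fun_f /= + _; lia.
    + by move=> _ /fun_f /= + ?; lia.
    move=> /nbrP[k [_ nx en]] /nbrP[l [_ mx em]]; rewrite en em /= => /addnI kl.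
    by congr inr; apply: hair_eq; rewrite ?nx ?mx // en em kl.
  move=> i /= id; have [ix|xi] := ltnP i (degree x).
    by have [y xy <-] := surj_f i ix; exists (inl y).
  have [|n [nx en]] := @hair_exists x [:: (i - degree x)%N]; first by rewrite /=; lia.
  exists (inr n); last by rewrite /= en /=; lia.
  by rewrite /= (hair_par_single en) nx.
have d0 := hair_gt0 n.
(* The parent takes the number 0 and the k-th child k + 1; a child is recognised by its longer
   word. *)
pose g (b : T + hair) : nat :=
  if b is inr m then
    if (size (hair_word n) < size (hair_word m))%N then (head 0%N (hair_word m)).+1 else 0
  else 0.
have nbrP b : attach_adj hair_par (inr n) b ->
    (b = hair_par n /\ g b = 0%N) \/
    exists m k, [/\ b = inr m, hair_root m = hair_root n,
      hair_word m = k :: hair_word n, (k < d.-1)%N & g b = k.+1].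
  have par0 : g (hair_par n) = 0%N.
    case E: (hair_par n) => [//|m] /=; have := hair_par_rk E.
    by rewrite ltnNge; case: ltnP => // /ltnW ->.
  case: b => [y|m] /=; first by move=> /eqP e; left; rewrite -e.
  case/orP => /eqP e; first by left; move: par0; rewrite e.
  right; exists m; case: (hair_parP m) e => // p k kd er ew [e].
  by subst p; exists k; rewrite ew /= ltnSn.
apply/pcard_eqP/bijPex; exists g; split.
- by move=> b /nbrP [[_ ->]|[m [k [_ _ _ kd ->]]]] /=; lia.
- move=> b c; rewrite !inE => /nbrP[[-> ->]|[m [k [-> mn em _ ->]]]].
    by move=> /nbrP[[-> _]|[m [k [_ _ _ _ ->]]]].
  move=> /nbrP[[_ ->]|[p [l [-> pn ep _ ->]]]] // [kl].
  by congr inr; apply: hair_eq; rewrite ?mn ?pn // em ep kl.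
case=> [_|i /= id]; last first.
  have [|m [mn em]] := @hair_exists (hair_root n) (i :: hair_word n).
    have := hair_wordP n; case: (hair_word n) => //= l w ->.
    by move: id; rewrite andbT /=; lia.
  exists (inr m); last by rewrite /= em /= ltnSn.
  by rewrite /neighbours /= (hair_par_cons mn em) eqxx orbT.
exists (hair_par n); first exact: attach_adj_par.
have [[_ //]|[m [k [e _ em _ _]]]] := nbrP _ (attach_adj_par hair_par n).
by have := hair_par_rk e; rewrite em /= ltnNge leqnSn.
Qed.

Section HairAction.
Variables (G : groupType) (a : tree_action G T).

(** The default [n] is never returned, because degrees are invariant. *)
Definition hair_act g (n : hair) : hair := insubd n (a g (hair_root n), hair_word n).

Lemma hair_actE g n :
  hair_root (hair_act g n) = a g (hair_root n) /\ hair_word (hair_act g n) = hair_word n.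
Proof.
suff : val (hair_act g n) = (a g (hair_root n), hair_word n).
  by rewrite /hair_root /hair_word => ->.
by apply: insubdK; rewrite unfold_in /= degree_act; apply: hair_wordP.
Qed.

Lemma hair_act1 n : hair_act 1 n = n.
Proof. by have [r w] := hair_actE 1 n; apply: hair_eq; rewrite ?r ?tact1. Qed.

Lemma hair_actM g h n : hair_act (g * h) n = hair_act g (hair_act h n).
Proof.
have [[r w] [r1 w1]] := (hair_actE (g * h) n, hair_actE g (hair_act h n)).
have [r2 w2] := hair_actE h n.
by apply: hair_eq; rewrite ?r ?r1 ?r2 ?tactM // w w1 w2.
Qed.

Lemma hair_par_act g n : hair_par (hair_act g n) = attach_act a hair_act g (hair_par n).
Proof.
have [r w] := hair_actE g n; case: (hair_parP n) => [k _ en|m k _ rn wn] /=.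
  by rewrite (@hair_par_single _ k) ?r // w.
have [rm wm] := hair_actE g m.
by apply: (@hair_par_cons _ _ k); rewrite ?r ?rm ?rn // w wn wm.
Qed.
End HairAction.
End RegularExtension.

Lemma bounded_embeds_regular (G : groupType) :
  (exists T : tree, uniformly_bounded T /\ embeds G (tree_aut T)) ->
  exists T : tree, regular T /\ embeds G (tree_aut T).
Proof.
move=> [T [[d Td] /embeds_action[a fa]]].
exists (regular_extension T d); split; first exact: regular_extension_regular.
apply: (@faithful_embeds _ _ (attach_action (@hair_par_rk T d) (hair_act1 a)
  (hair_actM a) (hair_par_act a))).
by move=> g gfix; apply: fa => x; have [] := gfix (inl x).
Qed.

(** * Normal forms in the path group *)

Section ProductGroup.
Variables (I : Type) (F : I -> groupType).

Definition prodg : Type := forall i, F i.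
HB.instance Definition _ := gen_eqMixin prodg.
HB.instance Definition _ := gen_choiceMixin prodg.

Implicit Types f g h : prodg.
Definition prodg_one : prodg := fun=> 1.
Definition prodg_mul f g : prodg := fun i => f i * g i.
Definition prodg_inv f : prodg := fun i => (f i)^-1.

Lemma prodg_mulA : associative prodg_mul.
Proof. by move=> f g h; apply: functional_extensionality_dep => i; apply: mulgA. Qed.
Lemma prodg_mul1 : left_id prodg_one prodg_mul.
Proof. by move=> f; apply: functional_extensionality_dep => i; apply: mul1g. Qed.
Lemma prodg_mulr1 : right_id prodg_one prodg_mul.
Proof. by move=> f; apply: functional_extensionality_dep => i; apply: mulg1. Qed.
Lemma prodg_mulV : left_inverse prodg_one prodg_inv prodg_mul.
Proof. by move=> f; apply: functional_extensionality_dep => i; apply: mulVg. Qed.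
Lemma prodg_mulrV : right_inverse prodg_one prodg_inv prodg_mul.
Proof. by move=> f; apply: functional_extensionality_dep => i; apply: mulgV. Qed.

HB.instance Definition _ := isGroup.Build prodg
  prodg_mulA prodg_mul1 prodg_mulr1 prodg_mulV prodg_mulrV.
End ProductGroup.

Section NormalForms.
Variable Y : graph_of_groups.
Let P : groupType := prodg (@vgroup Y).
Implicit Types (d : gedge Y * bool) (h s : P).

Definition vemb (v : gvert Y) (x : vgroup v) : P := dfwith (1 : P) x.

Lemma vemb_in v (x : vgroup v) : vemb x v = x.
Proof. exact: dfwith_in. Qed.

Lemma vemb_inj v : injective (@vemb v).
Proof. by move=> x y e; rewrite -(vemb_in x) e vemb_in. Qed.

Lemma vembM v (x y : vgroup v) : vemb (x * y) = vemb x * vemb y.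
Proof.
apply: functional_extensionality_dep => u.
rewrite [RHS]/(vemb x u * vemb y u); have [<-|uv] := eqVneq v u.
  by rewrite !vemb_in.
by rewrite /vemb !dfwith_out // [RHS]mulg1.
Qed.

Lemma vemb1 v : vemb (1 : vgroup v) = 1.
Proof. by apply: (mulgI (vemb (1 : vgroup v))); rewrite -vembM !mulg1. Qed.

Lemma vembV v (x : vgroup v) : vemb x^-1 = (vemb x)^-1.
Proof. by apply: (mulgI (vemb x)); rewrite -vembM !mulgV vemb1. Qed.

Definition dsrc d : gvert Y := letter_src (inr d).
Definition dinv d : gedge Y * bool := (d.1, ~~ d.2).

Lemma dinvK d : dinv (dinv d) = d.
Proof. by case: d => e b; rewrite /dinv /= negbK. Qed.

Definition dmap d : egroup d.1 -> vgroup (dsrc d) :=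
  match d with
  | (e, true) => to_src e
  | (e, false) => to_tgt e
  end.

Lemma dmap_inj d : injective (@dmap d).
Proof. by case: d => e [] /=; [exact: to_src_inj|exact: to_tgt_inj]. Qed.

Lemma dmapM d (a b : egroup d.1) : dmap (a * b) = dmap a * dmap b.
Proof. by case: d a b => e [] a b /=; rewrite gmulfM. Qed.

Definition jmap d (a : egroup d.1) : P := vemb (dmap a).

Lemma jmap_inj d : injective (@jmap d).
Proof. by move=> a b /vemb_inj/dmap_inj. Qed.

Lemma jmapM d (a b : egroup d.1) : jmap (a * b) = jmap a * jmap b.
Proof. by rewrite /jmap dmapM vembM. Qed.

Lemma jmap1 d : jmap (1 : egroup d.1) = 1.
Proof. by apply: (mulgI (jmap (1 : egroup d.1))); rewrite -jmapM !mulg1. Qed.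

Lemma jmapV d (a : egroup d.1) : jmap a^-1 = (jmap a)^-1.
Proof. by apply: (mulgI (jmap a)); rewrite -jmapM !mulgV jmap1. Qed.

Lemma jrange_subgroup d : subgroup (range (@jmap d)).
Proof.
apply: subgroupI => [|_ _ [a _ <-] [b _ <-]|_ [a _ <-]].
- by exists 1 => //; exact: jmap1.
- by exists (a * b) => //; exact: jmapM.
- by exists a^-1 => //; exact: jmapV.
Qed.

Lemma dmap_range_subgroup d : subgroup (range (@dmap d)).
Proof.
apply: subgroupI => [|_ _ [a _ <-] [b _ <-]|_ [a _ <-]].
- by exists 1 => //; apply: vemb_inj; rewrite vemb1; exact: jmap1.
- by exists (a * b) => //; exact: dmapM.
- by exists a^-1 => //; apply: vemb_inj; rewrite vembV; exact: jmapV.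
Qed.

Definition rep0 d h : P := xget 1 (lcoset h (range (@jmap d))).
(* Dividing by [rep0 d 1] makes 1 the representative of the trivial coset. *)
Definition rep d h : P := rep0 d h * (rep0 d 1)^-1.

Lemma rep0P d h : range (@jmap d) (h^-1 * rep0 d h).
Proof. by apply/lcosetP; apply: xgetI; apply: lcoset_refl; apply: jrange_subgroup. Qed.

Lemma repP d h : range (@jmap d) (h^-1 * rep d h).
Proof.
rewrite /rep mulgA; apply: subgroupM (jrange_subgroup d) (rep0P d h) _.
apply: subgroupV (jrange_subgroup d) _.
by have := rep0P d 1; rewrite invg1 mul1g.
Qed.

Lemma rep_coset d h h' : range (@jmap d) (h^-1 * h') -> rep d h = rep d h'.
Proof.
move=> hh'; rewrite /rep /rep0; congr (xget 1 _ * _).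
by apply/lcoset_eqP => //; apply: jrange_subgroup.
Qed.

Lemma rep_mul d h (a : egroup d.1) : rep d (h * jmap a) = rep d h.
Proof. by apply/esym/rep_coset; rewrite mulKg; exists a. Qed.

Lemma rep1 d : rep d 1 = 1.
Proof. exact: mulgV. Qed.

Lemma rep_jmap d (a : egroup d.1) : rep d (jmap a) = 1.
Proof. by rewrite -[jmap a]mul1g rep_mul rep1. Qed.

Lemma rep_rep d h : rep d (rep d h) = rep d h.
Proof. exact/esym/rep_coset/repP. Qed.

Definition lift d h : egroup d.1 := xget 1 [set a | h = rep d h * jmap a].

Lemma liftP d h : h = rep d h * jmap (lift d h).
Proof.
have [a _ e] := repP d h.
have ha : h = rep d h * jmap a^-1 by rewrite jmapV e !gnorm.
exact: (@xgetI _ 1 [set b | h = rep d h * jmap b] _ ha).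
Qed.

Lemma lift_mul d h (a : egroup d.1) : lift d (h * jmap a) = lift d h * a.
Proof.
apply: jmap_inj; apply: (mulgI (rep d h)).
by rewrite -{1}(rep_mul h a) -liftP jmapM mulgA -liftP.
Qed.

Lemma lift_rep d h : rep d h = h -> lift d h = 1.
Proof.
move=> e; apply: jmap_inj; apply: (mulgI (rep d h)).
by rewrite -liftP jmap1 mulg1.
Qed.

Lemma lift_jmap d (a : egroup d.1) : lift d (jmap a) = a.
Proof. by rewrite -[jmap a]mul1g lift_mul lift_rep ?mul1g // rep1. Qed.

(* The state (l, h) with l = [:: (d_k, s_k); ...; (d_1, s_1)] stands for the
   normal form s_1 d_1 ... s_k d_k h in the HNN extension of the product P of
   all the vertex groups with one stable letter for every edge.  Since every
   word of Y makes sense there, letters act on all states from the right. *)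
Definition state : Type := (seq (gedge Y * bool * P) * P)%type.

Definition pops d (l : seq (gedge Y * bool * P)) h : bool :=
  if l is (d', _) :: _ then (d' == dinv d) && (rep d h == 1) else false.

(** Right multiplication by the stable letter d. Write h = r j(a) with r the coset representative
    and a in the edge group; a passes across d and appears in the group at the other end. What
    remains is r d, which cancels when r = 1 and the preceding stable letter is the inverse of d. *)
Definition estep d (st : state) : state :=
  let h := jmap (d := dinv d) (lift d st.2) in
  if pops d st.1 st.2 then (behead st.1, (head (d, 1) st.1).2 * h)
  else ((d, rep d st.2) :: st.1, h).

Definition vstep h (st : state) : state := (st.1, st.2 * h).

Definition step (st : state) (a : letter Y) : state :=
  match a with
  | inl u => vstep (vemb (tagged u)) st
  | inr d => estep d st
  end.

Definition run (st : state) (w : seq (letter Y)) : state := foldl step st w.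

Fixpoint reduced (l : seq (gedge Y * bool * P)) : bool :=
  if l is (d, s) :: l' then [&& rep d s == s, ~~ pops d l' s & reduced l']
  else true.

Lemma estep_reduced d st : reduced st.1 -> reduced (estep d st).1.
Proof.
rewrite /estep; case: ifP => [_|np] /=; first by case: st.1 => [|[d' s] l] //= /and3P[].
move=> ->; rewrite rep_rep eqxx andbT /=; apply/negP => h.
by move/negP: np; apply; move: h; rewrite /pops;
  case: st.1 => // -[d' s] l; rewrite rep_rep.
Qed.

Lemma run_reduced st w : reduced st.1 -> reduced (run st w).1.
Proof.
elim: w st => //= -[u|d] w IH st rst; apply: IH => //.
exact: estep_reduced.
Qed.

Lemma estepK d st : reduced st.1 -> estep (dinv d) (estep d st) = st.
Proof.
case: st => l h rl; rewrite {2}/estep /=; case: ifP => pop.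
  case: l rl pop => [|[d' s] l] //= /and3P[/eqP rs np rl] /andP[/eqP e /eqP r1].
  subst d'; rewrite /estep /= rep_mul lift_mul rs (lift_rep rs) mul1g.
  (* The cancelled letter is put back: since the list was reduced, it cannot cancel against [l]
     instead. *)
  have -> : pops (dinv d) l (s * jmap (d := dinv d) (lift d h)) = false.
    apply: negbTE; apply: contra np; rewrite /pops; case: l {rl} => // -[d' ?] ?.
    by rewrite rep_mul.
  congr (_, _); rewrite [RHS](liftP d h) r1 mul1g.
  by case: d {rs np r1} => e [].
rewrite /estep /= rep_jmap lift_jmap.
by case: d {pop} => e [] /=; rewrite !eqxx /=; congr (_, _);
  [rewrite [RHS](liftP (e, true))|rewrite [RHS](liftP (e, false))].
Qed.

Lemma estep_jmap d st (a : egroup d.1) :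
  estep d (vstep (jmap a) st) = vstep (jmap (d := dinv d) a) (estep d st).
Proof.
case: st => l h; rewrite /estep /vstep /= rep_mul lift_mul.
have -> : pops d l (h * jmap a) = pops d l h.
  by rewrite /pops; case: l => // -[d' ?] ?; rewrite rep_mul.
by case: ifP => _ /=; rewrite (jmapM (d := dinv d)) // mulgA.
Qed.

(** Van der Waerden's argument: both sides of each defining relation act alike on reduced states, so
    the final state is an invariant of the word. *)
Lemma run_eq w w' : word_eq w w' -> forall st, reduced st.1 -> run st w = run st w'.
Proof.
elim=> {w w'} //.
- by move=> w w' _ IH st rst; rewrite IH.
- by move=> w w' w'' _ IH1 _ IH2 st rst; rewrite IH1 // IH2.
- move=> u u' w w' _ IH1 _ IH2 st rst; rewrite /run !foldl_cat.
  by rewrite -![foldl _ _ _]/(run _ _) IH1 // IH2 // run_reduced.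
- by move=> v [l h] _; rewrite /= /vstep vemb1 mulg1.
- by move=> v x y [l h] _; rewrite /= /vstep /= vembM mulgA.
- by move=> e b st rst; exact: (@estepK (e, b)).
move=> e a st rst.
rewrite -[LHS]/(estep (dinv (e, true)) (vstep (jmap (d := dinv (e, true)) a)
  (estep (e, true) st))).
by rewrite -(@estep_jmap (e, true)) (@estepK (e, true)).
Qed.
End NormalForms.

(** * The Bass-Serre tree *)

Section WordEquality.
Variable Y : graph_of_groups.
Implicit Types (w u : seq (letter Y)) (d : gedge Y * bool).

Lemma we_catl u w w' : word_eq w w' -> word_eq (u ++ w) (u ++ w').
Proof. exact/we_cat/we_refl. Qed.

Lemma we_catr u w w' : word_eq w w' -> word_eq (w ++ u) (w' ++ u).
Proof. by move/we_cat; apply; apply: we_refl. Qed.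

Lemma we_cons a w w' : word_eq w w' -> word_eq (a :: w) (a :: w').
Proof. exact: (@we_catl [:: a]). Qed.

Lemma we_dart d (a : egroup d.1) :
  word_eq [:: vlet (dmap a); inr d] [:: inr d; vlet (dmap (d := dinv d) a)].
Proof.
case: d a => e [] a /=.
  apply: we_trans (we_catr [:: elet e true] (we_sym (we_edge a))) _.
  exact: (we_catl [:: elet e true; vlet (to_tgt e a)] (we_inv e false)).
apply: we_trans (we_catl [:: elet e false] (we_edge a)).
exact: (we_catr [:: vlet (to_tgt e a); elet e false] (we_sym (we_inv e false))).
Qed.
End WordEquality.

Arguments dmap : simpl never.

(** * Normal forms of walks, and the tree they form *)

Section TypedNormalForms.
Variables (Y : graph_of_groups) (v0 : gvert Y).
Let P : groupType := prodg (@vgroup Y).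
Let nform : Type := seq (gedge Y * bool * P).
Implicit Types (w u : seq (letter Y)) (d : gedge Y * bool) (l : seq (gedge Y * bool * P)).

Definition nend l : gvert Y := if l is (d, _) :: _ then dsrc (dinv d) else v0.

Fixpoint nword l : seq (letter Y) :=
  if l is (d, s) :: l' then nword l' ++ [:: vlet (s (dsrc d)); inr d] else [::].

Fixpoint typed l : bool :=
  if l is (d, s) :: l' then
    [&& dsrc d == nend l', s == vemb (s (dsrc d)) & typed l']
  else true.

Definition represents v w (st : state Y) : Prop :=
  [/\ typed st.1, reduced st.1, nend st.1 = v &
      exists g : vgroup v, st.2 = vemb g /\ word_eq w (nword st.1 ++ [:: vlet g])].

Lemma dtgtE d : letter_tgt (inr d : letter Y) = dsrc (dinv d).
Proof. by case: d => e []. Qed.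

Lemma represents_step v w st a :
  letter_src a = v -> represents v w st ->
  represents (letter_tgt a) (w ++ [:: a]) (step st a).
Proof.
case: st => l h av [/= tl rl lv [g [hg wg]]]; subst h.
case: a av => [[u x]|d] av.
  move: lv; rewrite /= in av; subst v => lv; split=> //.
  exists (g * x); split; first by rewrite vembM.
  apply: we_trans (we_catr _ wg) _; rewrite -catA; apply: we_catl.
  exact: we_mul.
move: lv; rewrite -/(dsrc d) in av; subst v => lv; rewrite [X in represents X]dtgtE.
set x := lift d (vemb g); set s := g * (dmap x)^-1.
have sE : rep d (vemb g) = vemb s.
  by rewrite vembM vembV -/(jmap x); apply: (canRL (mulgK _)); rewrite -liftP.
have {}wg : word_eq (w ++ [:: inr d])
    (nword l ++ [:: vlet s; inr d; vlet (dmap (d := dinv d) x)]).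
  apply: we_trans (we_catr _ wg) _; rewrite -catA; apply: we_catl.
  have -> : g = s * dmap x by rewrite mulgVK.
  apply: we_trans (we_catr [:: inr d] (we_sym (we_mul _ _))) _.
  exact: we_cons (we_dart _).
rewrite /= /estep /=; case: ifP => pop; last first.
  split=> //=.
  - by rewrite lv eqxx tl sE vemb_in eqxx.
  - by rewrite rl rep_rep eqxx andbT; apply/negP; move: pop; rewrite /pops;
      case: l {tl rl lv wg} => // -[d' ?] ?; rewrite rep_rep => ->.
  by exists (dmap (d := dinv d) x); rewrite sE vemb_in -catA.
case: l tl rl lv wg pop => [|[d' s'] l] //= /and3P[/eqP ls /eqP s'E tl] /and3P[_ _ rl] _.
move=> + /andP[/eqP e /eqP s1]; subst d'.
move: s1; rewrite sE -(vemb1 (dsrc d)) => /vemb_inj ->.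
rewrite -catA /= => wg; split=> //.
exists (s' (dsrc (dinv d)) * dmap (d := dinv d) x); split; first by rewrite vembM -s'E.
apply: we_trans wg _; apply: we_catl.
apply: we_trans (we_mul _ _); apply: we_cons.
apply: (we_trans (w' := [:: inr (dinv d); inr d; vlet (dmap (d := dinv d) x)])).
  exact: (we_cons _ (we_catr [:: inr d; vlet (dmap (d := dinv d) x)] (we_one _))).
have h : word_eq [:: inr (dinv d); inr d : letter Y] [::].
  by case: (d) => e b; have := we_inv e (~~ b); rewrite negbK.
exact: (we_catr _ h).
Qed.

Let run0 w : state Y := run ([::], 1) w.

Lemma run0_rcons w a : run0 (w ++ [:: a]) = step (run0 w) a.
Proof. by rewrite /run0 /run foldl_cat. Qed.

Lemma walk_rcons (u v : gvert Y) w (a : letter Y) :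
  walk u v (w ++ [:: a]) = walk u (letter_src a) w && (letter_tgt a == v).
Proof.
elim: w u => [|b w IH] u /=; first by rewrite eq_sym.
by rewrite IH andbA.
Qed.

(** The complement of [run_eq]: the state of a walk spells a word equal to it, so the state
    determines the walk up to [word_eq]. *)
Lemma walk_represents v w : walk v0 v w -> represents v w (run0 w).
Proof.
elim/last_ind: w v => [|w a IH] v.
  move=> /= /eqP <-; split=> //; exists 1; rewrite vemb1; split=> //.
  exact/we_sym/we_one.
rewrite -cats1 walk_rcons run0_rcons => /andP[/IH h /eqP <-].
exact: represents_step h.
Qed.

Lemma nword_walk l : typed l -> walk v0 (nend l) (nword l).
Proof.
elim: l => [|[d s] l IH] //= /and3P[/eqP ls _ /IH h]; apply: walk_cat h _.
by case: (d) ls => e [] /= <-; rewrite /= !eqxx.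
Qed.

Lemma run0_nword l : typed l -> reduced l -> run0 (nword l) = (l, 1).
Proof.
elim: l => [|[d s] l IH] //= /and3P[_ /eqP sE tl] /and3P[/eqP rs np rl].
rewrite -cat1s catA 2!run0_rcons IH //= /vstep /= mul1g -sE /estep /=.
by rewrite (negbTE np) rs lift_rep // jmap1.
Qed.

(* Vertices of the Bass-Serre tree, i.e. cosets of vertex groups in the path
   group, are encoded by the list part of their normal forms. *)
Definition nvertex : Type := {l : nform | typed l && reduced l}.
HB.instance Definition _ := SubChoice.on nvertex.
Implicit Types x y : nvertex.

Definition nroot : nvertex := exist _ [::] isT.
Definition nvertex_of w : nvertex := insubd nroot (run0 w).1.

Lemma val_nvertex_of v w : walk v0 v w -> val (nvertex_of w) = (run0 w).1.
Proof. by case/walk_represents => tl rl _ _; apply: insubdK; rewrite unfold_in tl rl. Qed.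

Lemma nvertex_of_eq w w' : word_eq w w' -> nvertex_of w = nvertex_of w'.
Proof. by move=> /run_eq e; rewrite /nvertex_of /run0 e. Qed.

Lemma nvertex_of_vlet w v (g : vgroup v) : nvertex_of (w ++ [:: vlet g]) = nvertex_of w.
Proof. by rewrite /nvertex_of run0_rcons. Qed.

Definition xword x := nword (val x).
Definition xend x := nend (val x).

Lemma xword_walk x : walk v0 (xend x) (xword x).
Proof. by apply: nword_walk; case/andP: (valP x). Qed.

Lemma run0_xword x : run0 (xword x) = (val x, 1).
Proof. by case/andP: (valP x) => ? ?; apply: run0_nword. Qed.

Lemma xwordK x : nvertex_of (xword x) = x.
Proof. by apply: val_inj; rewrite (val_nvertex_of (xword_walk x)) run0_xword. Qed.

Lemma nvertex_ofP v w : walk v0 v w ->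
  exists g : vgroup v, word_eq w (xword (nvertex_of w) ++ [:: vlet g]).
Proof.
move=> wv; have [_ _ _ [g [_ wg]]] := walk_represents wv.
by exists g; rewrite /xword (val_nvertex_of wv).
Qed.

(** The tree is rooted at the trivial coset, and deleting the last syllable leads to the parent. *)
Definition nadj x y : bool :=
  (val x != [::]) && (behead (val x) == val y) ||
  (val y != [::]) && (behead (val y) == val x).

Lemma nadj_sym : symmetric nadj.
Proof. by move=> x y; rewrite /nadj orbC. Qed.

Lemma nadj_size x y : nadj x y ->
  (size (val x) = (size (val y)).+1 /\ behead (val x) = val y) \/
  (size (val y) = (size (val x)).+1 /\ behead (val y) = val x).
Proof.
by case/orP => /andP[n0 /eqP e]; [left|right]; split=> //;
  rewrite -e size_behead prednK // lt0n size_eq0.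
Qed.

Lemma nadj_irr : irreflexive nadj.
Proof. by move=> x; apply/negP => /nadj_size; lia. Qed.

Lemma nadj_connected x y : exists p, path nadj x p /\ last x p = y.
Proof.
suff H z : joined nadj z nroot.
  exact: joined_trans (H x) (joined_sym nadj_sym (H y)).
case: z => l; elim: l => [|[d s] l IH] lok.
  by have -> : exist _ [::] lok = nroot; [exact: val_inj|exact: joined_refl].
have lok' : typed l && reduced l by case/andP: lok => /= /and3P[_ _ ->] /and3P[].
by apply: joined_trans (IH lok'); apply: joined_edge; rewrite /nadj /= eqxx.
Qed.

Lemma nadj_acyclic c : (2 < size c)%N -> ~ ucycle nadj c.
Proof.
move: c; apply: (acyclic_height (h := fun x : nvertex => size (val x))).
- exact: nadj_sym.
- by move=> x y /nadj_size; lia.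
- move=> x y z /nadj_size xy /nadj_size xz yx zx; apply: val_inj.
  case: xy => -[exy ey]; last by lia.
  by case: xz => -[exz ez]; [rewrite -ey -ez|lia].
case=> [|x [|y c]] // _ /=; rewrite !size_eq0 => /and3P[/eqP x0 /eqP y0 _].
case/andP=> _ /=; rewrite inE.
have -> : x = y by apply: val_inj; exact: etrans x0 (esym y0).
by rewrite eqxx.
Qed.

Definition bass_serre : tree :=
  Tree nadj_sym nadj_irr (inhabits nroot) nadj_connected nadj_acyclic.

Let G : groupType := pi1 v0.

Definition pact (p : G) x : nvertex := nvertex_of (val (repr p) ++ xword x).

Lemma pact_pi (p : loop v0) x : pact (\pi_(pi1 v0) p) x = nvertex_of (val p ++ xword x).
Proof. exact/nvertex_of_eq/we_catr/pi1_reprP. Qed.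

Lemma pact1 x : pact 1 x = x.
Proof. by rewrite [1]/(pi1_one v0) pact_pi xwordK. Qed.

Lemma pactM (p q : G) x : pact (p * q) x = pact p (pact q x).
Proof.
rewrite [p * q]/(pi1_mul p q) pact_pi /= -catA.
(* The word for [q] and [x] differs from that of the vertex [pact q x] by a final vertex letter,
   which does not change the coset. *)
have [g e] := nvertex_ofP (walk_cat (valP (repr q)) (xword_walk x)).
rewrite (nvertex_of_eq (we_catl _ e)) catA nvertex_of_vlet.
by [].
Qed.

Lemma estep_nadj d (st : state Y) :
  (st.1 != [::] /\ behead st.1 = (estep d st).1) \/
  ((estep d st).1 != [::] /\ behead (estep d st).1 = st.1).
Proof.
rewrite /estep; case: ifP => [p|_]; last by right.
by left; split=> //; case: (st.1) p.
Qed.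

(** The word of a child is that of its parent followed by a vertex letter and a dart. Whatever
    precedes it, a dart adds or removes exactly one syllable. *)
Lemma pact_adj (p : G) x y : nadj x y -> nadj (pact p x) (pact p y).
Proof.
wlog xy : x y / val y != [::] /\ behead (val y) = val x.
  move=> H; case/orP => /andP[n0 /eqP e]; last first.
    by apply: H => //; rewrite /nadj n0 e eqxx orbT.
  by rewrite nadj_sym; apply: H => //; rewrite /nadj n0 e eqxx orbT.
move=> _; have [d [a ey]] : exists d a, val y = (d, a) :: val x.
  by case: xy; case: (val y) => // -[d a] l _ /= <-; exists d, a.
have ew : val (repr p) ++ xword y =
    ((val (repr p) ++ xword x) ++ [:: vlet (a (dsrc d))]) ++ [:: inr d].
  by rewrite /xword ey /= -!catA.
have wx := val_nvertex_of (walk_cat (valP (repr p)) (xword_walk x)).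
have wy := val_nvertex_of (walk_cat (valP (repr p)) (xword_walk y)).
rewrite /nadj wx wy ew 2!run0_rcons /=.
have [[n0 ->]|[n0 ->]] :=
  estep_nadj d (vstep (vemb (a (dsrc d))) (run0 (val (repr p) ++ xword x))).
  by rewrite n0 eqxx.
by rewrite n0 eqxx orbT.
Qed.

Definition pi1_action : tree_action G bass_serre :=
  @TreeAction G bass_serre pact pact1 pactM pact_adj.

Definition vloop (g : vgroup v0) : loop v0 :=
  exist _ [:: vlet g] (introT andP (conj (eqxx v0) (eqxx v0))).
Definition vpi1 (g : vgroup v0) : G := \pi_(pi1 v0) (vloop g).

Lemma vpi1M : {morph vpi1 : g h / g * h}.
Proof.
move=> g h; apply: etrans (esym (pi1_mulE (vloop g) (vloop h))); apply/pi1P.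
exact/we_sym/we_mul.
Qed.

Lemma vpi1_inj : injective vpi1.
Proof.
move=> g h /pi1P /run_eq /(_ ([::], 1) isT) [].
by rewrite !mul1g => /vemb_inj.
Qed.

Lemma pact_root (p : G) : pact p nroot = nroot <-> range vpi1 p.
Proof.
split=> [pr|[g _ <-]].
  have [g e] := nvertex_ofP (walk_cat (valP (repr p)) (xword_walk nroot)).
  exists g => //; rewrite -[p in RHS]reprK; apply/pi1P => /=.
  by move: e; rewrite -/(pact p nroot) pr /= cats0 => /we_sym.
by rewrite pact_pi; apply: etrans (nvertex_of_vlet [::] g) _; exact: (xwordK nroot).
Qed.

Lemma finite_reps d :
  finite_index [set: vgroup (dsrc d)] (range (@dmap _ d)) ->
  exists s : seq P, forall x : vgroup (dsrc d), rep d (vemb x) \in s.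
Proof.
case/finite_seqP => s cs; exists [seq rep d (vemb (xget 1 C)) | C <- s] => x.
have sR := @dmap_range_subgroup Y d.
apply/mapP; exists (lcoset x (range (@dmap _ d))).
  by suff : [set` s] (lcoset x (range (@dmap _ d))); [|rewrite -cs; exists x].
have [a _ ea] : range (@dmap _ d) (x^-1 * xget 1 (lcoset x (range (@dmap _ d)))).
  by apply/lcosetP; apply: xgetI; apply: lcoset_refl.
apply: rep_coset; rewrite -vembV -vembM; exists a => //.
by rewrite /jmap ea.
Qed.

Lemma bass_serre_bounded : finite_index_edges Y -> uniformly_bounded bass_serre.
Proof.
move=> Yf.
have /choice[S SP] d :
    exists s : seq P, forall x : vgroup (dsrc d), rep d (vemb x) \in s.
  by apply: finite_reps; case: d => e []; have [] := Yf e.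
pose K := [seq (d, s) | d <- enum {: gedge Y * bool}, s <- S d].
(* A neighbour is the parent or adds a syllable whose group element is one of the finitely many
   coset representatives. *)
exists (size K).+1 => x.
apply: (@card_le_inj _ _ (fun y : nvertex => val y) _ _
  (behead (val x) :: [seq k :: val x | k <- K])).
- exact: val_inj.
- by rewrite /= size_map.
move=> y xy; rewrite inE.
case/orP: xy => /andP[y0 /eqP e]; first by rewrite e eqxx.
apply/orP; right; case/andP: (valP y); move: y0 e; case: (val y) => // -[d s] l _ /= <-.
case/and3P=> _ /eqP sE _ /and3P[/eqP rs _ _]; apply/mapP; exists (d, s) => //.
apply/allpairsPdep; exists d, s; split=> //; first by rewrite mem_enum.
by rewrite -[X in X \in _]rs sE; apply: SP.
Qed.
End TypedNormalForms.

Lemma isomorphic_embeds (G H K : groupType) :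
  isomorphic G H -> embeds H K -> embeds G K.
Proof.
move=> [f fb] [g gI].
have gfM : {morph (g \o f) : x y / x * y} by move=> x y /=; rewrite !gmulfM.
pose m := @isMultiplicative.Build G K (g \o f) gfM.
pose gf : {multiplicative G -> K} := HB.pack (g \o f) m.
by exists gf; apply: inj_comp gI (bij_inj fb).
Qed.

Lemma pi1_embeds_bounded (Y : graph_of_groups) (v0 : gvert Y) n :
  finite_index_edges Y -> has_index_chain (vgroup v0) n ->
  exists T : tree, uniformly_bounded T /\ embeds (pi1 v0) (tree_aut T).
Proof.
move=> Yf [K [K0 [sK [_ [KS [Kn Kcap]]]]]].
pose m := @isMultiplicative.Build _ (pi1 v0) (@vpi1 Y v0) (@vpi1M Y v0).
pose f : {multiplicative vgroup v0 -> pi1 v0} := HB.pack (@vpi1 Y v0) m.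
apply: (@chain_extension (pi1 v0) _ (pi1_action v0) (nroot v0)
  (fun i => f @` K i) n).
- by move=> i; apply: subgroup_image.
- by move=> p; rewrite K0; exact: iff_sym (pact_root p).
- by move=> i _ [x /KS Kx <-]; exists x.
- by move=> i; apply: index_le_image.
- move=> p Kp; have [x _ xp] := Kp 0%N.
  suff : (\bigcap_(i in [set: nat]) K i) x.
    by rewrite Kcap -xp => /= ->; exact: (morph1 f).
  (* By injectivity of [vpi1], the preimages of [p] found in the various [K i] are one and the same
     element. *)
  by move=> i _; have [y Ky yp] := Kp i; rewrite -(@vpi1_inj _ _ y x) // [LHS]yp -xp.
exact: bass_serre_bounded.
Qed.

(** * The graph of groups of an action *)

Section Orbits.
Variables (G : groupType) (X : choiceType) (act : G -> X -> X).
Hypotheses (act1 : forall x, act 1 x = x)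
  (actM : forall g h x, act (g * h) x = act g (act h x)).

Lemma actK g : cancel (act g) (act g^-1).
Proof. by move=> x; rewrite -actM mulVg act1. Qed.

Definition orep x : X := xget x [set y | exists g, act g x = y].

Lemma orepP x : exists g, act g (orep x) = x.
Proof.
have [g <-] : [set y | exists g, act g x = y] (orep x).
  by apply: xgetPex; exists (act 1 x), 1.
by exists g^-1; rewrite actK.
Qed.

Lemma orep_act g x : orep (act g x) = orep x.
Proof.
rewrite /orep; have -> : [set y | exists g', act g' (act g x) = y] =
                        [set y | exists g', act g' x = y].
  apply/predeqP => y; split=> -[k <-]; first by exists (k * g).
  by exists (k * g^-1); rewrite actM actK.
rewrite /xget; case: pselect => // -[]; exists (act 1 x); apply/asboolP; by exists 1.
Qed.

Lemma orep_orep x : orep (orep x) = orep x.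
Proof. by have [g e] := orepP x; rewrite -{2}e orep_act. Qed.

Definition ofactor x : G := xget 1 [set g | act g (orep x) = x].

Lemma ofactorP x : act (ofactor x) (orep x) = x.
Proof. exact: (@xgetPex _ 1 [set g | act g (orep x) = x] (orepP x)). Qed.

Lemma ofactorVP x : act (ofactor x)^-1 x = orep x.
Proof. by rewrite -{2}(ofactorP x) actK. Qed.

Definition stab x : set G := [set g | act g x = x].

Lemma stab_subgroup x : subgroup (stab x).
Proof.
apply: subgroupI => [|g h gx hx|g gx]; rewrite /stab /=.
- exact: act1.
- by rewrite actM hx.
- by rewrite -{1}gx actK.
Qed.
End Orbits.

Lemma sub_valM (G : groupType) (K : set G) (sK : subgroup K)
  (x y : subgroup_type sK) : val (x * y) = val x * val y.
Proof. by []. Qed.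

(** * The graph of groups spanned by the orbits of a finite set *)

Section QuotientGraph.
Variables (G : groupType) (X : choiceType) (act : G -> X -> X) (adj : rel X).
Variables (c : X -> bool) (x0 : X) (F : seq X).
Hypotheses (act1 : forall x, act 1 x = x)
  (actM : forall g h x, act (g * h) x = act g (act h x))
  (adjC : symmetric adj)
  (act_adj : forall g x y, adj x y -> adj (act g x) (act g y))
  (c_act : forall g x, c (act g x) = c x)
  (c_adj : forall x y, adj x y -> c y = ~~ c x).
Local Notation rep := (orep act).
Local Notation gam := (ofactor act).
Hypotheses (rep_x0 : rep x0 = x0) (Fx0 : x0 \in F)
  (Fpath : forall x, x \in F ->
    exists p, [/\ path adj x0 p, last x0 p = x & {subset p <= F}]).

Definition act2 g (p : X * X) : X * X := (act g p.1, act g p.2).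
Lemma act21 p : act2 1 p = p.
Proof. by case: p => x y; rewrite /act2 /= !act1. Qed.
Lemma act2M g h p : act2 (g * h) p = act2 g (act2 h p).
Proof. by rewrite /act2 /= !actM. Qed.
Local Notation rep2 := (orep act2).

Definition qverts := map rep F.
(** Starting at the end coloured by [c] lists each edge orbit once. As the colouring is invariant,
    an element preserving an edge fixes both its ends. *)
Definition qedges :=
  [seq rep2 p | p <- [seq (x, y) | x <- F, y <- F] & adj p.1 p.2 && c p.1].
Definition qvert : finType := seq_sub qverts.
Definition qedge : finType := seq_sub qedges.

Lemma qbase_subproof : x0 \in qverts.
Proof. by rewrite -rep_x0; apply: map_f. Qed.
Definition qbase : qvert := SeqSub qbase_subproof.

Definition qpt (d : qedge * bool) : X := if d.2 then (val d.1).1 else (val d.1).2.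
Definition flip (d : qedge * bool) := (d.1, ~~ d.2).

Lemma qedgeP (e : qedge) :
  exists x y g, [/\ x \in F, y \in F, adj x y, c x & act2 g (val e) = (x, y)].
Proof.
have /mapP[[x y]] := valP e; rewrite mem_filter /= => /andP[/andP[xy cx]].
case/allpairsP => -[x' y'] /= [xF yF [ex ey]] ->; subst x' y'.
by have [g e2] := orepP act21 act2M (x, y); exists x, y, g.
Qed.

Lemma rep_qpt d : rep (qpt d) \in qverts.
Proof.
case: d => e b; have [x [y [g [xF yF _ _ [ex ey]]]]] := qedgeP e.
by rewrite /qpt /=; case: b; rewrite -(orep_act act1 actM g) ?ex ?ey map_f.
Qed.

Lemma qpt_adj d : adj (qpt d) (qpt (flip d)).
Proof.
case: d => e b; have [x [y [g [_ _ xy _ [ex ey]]]]] := qedgeP e.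
have {}xy : adj (val e).1 (val e).2.
  by rewrite -(actK act1 actM g (val e).1) -(actK act1 actM g (val e).2) ex ey act_adj.
by case: b; rewrite /qpt //= adjC.
Qed.

Lemma qpt_color d : c (qpt d) = d.2.
Proof.
case: d => e b; have [x [y [g [_ _ xy cx [ex ey]]]]] := qedgeP e.
by case: b; rewrite /qpt /= -(c_act g) ?ex ?ey // (c_adj xy) cx.
Qed.

Lemma qdart_exists x y : x \in F -> y \in F -> adj x y ->
  exists d g, act g (qpt d) = x /\ act g (qpt (flip d)) = y.
Proof.
move=> xF yF xy.
wlog cx : x y xF yF xy / c x.
  move=> H; have [cx|cx] := boolP (c x); first exact: H.
  have [||d [g [e1 e2]]] := H y x yF xF; rewrite 1?adjC ?(c_adj xy) //.
  by exists (flip d), g; split=> //; case: d e1 {e2} => e [].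
have eE : rep2 (x, y) \in qedges.
  apply: map_f; rewrite mem_filter /= xy cx /=; apply/allpairsP; by exists (x, y).
have [g [e1 e2]] := orepP act21 act2M (x, y).
by exists (SeqSub eE, true), g.
Qed.

(* The chosen lift of the edge [d] starts at [qpt d], whereas the vertex group
   at [qend d] is the stabiliser of [rep (qpt d)]: conjugation by [gam (qpt d)]
   makes up for the difference. *)
Definition qend d : qvert := insubd qbase (rep (qpt d)).

Lemma val_qend d : val (qend d) = rep (qpt d).
Proof. exact: insubdK (rep_qpt d). Qed.

Definition qvgroup (v : qvert) : groupType :=
  subgroup_type (stab_subgroup act1 actM (val v)).
Definition qegroup (e : qedge) : groupType :=
  subgroup_type (stab_subgroup act21 act2M (val e)).

Lemma qegroup_fix (d : qedge * bool) (a : qegroup d.1) : act (val a) (qpt d) = qpt d.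
Proof.
have h : act2 (val a) (val d.1) = val d.1 := set_mem (valP a).
by rewrite /qpt; case: d.2; [exact: (congr1 fst h)|exact: (congr1 snd h)].
Qed.

Lemma qmap_subproof d (a : qegroup d.1) :
  (gam (qpt d))^-1 * (val a * gam (qpt d)) \in stab act (val (qend d)).
Proof.
apply/mem_set; rewrite /stab /= val_qend !actM ofactorP //.
by rewrite qegroup_fix ofactorVP.
Qed.

Definition qmap d (a : qegroup d.1) : qvgroup (qend d) :=
  exist (fun x : G => x \in stab act (val (qend d))) _ (qmap_subproof a).

Lemma qmapM d : {morph @qmap d : a b / a * b}.
Proof. by move=> a b; apply: val_inj; rewrite /= !gnorm. Qed.

Lemma qmap_inj d : injective (@qmap d).
Proof.
move=> a b /(congr1 val) /= /mulgI /mulIg e; exact: val_inj.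
Qed.

Definition qhom d : {multiplicative qegroup d.1 -> qvgroup (qend d)} :=
  HB.pack (@qmap d) (@isMultiplicative.Build _ _ (@qmap d) (@qmapM d)).

Definition qrel (a b : qvert) : bool :=
  [exists e : qedge, ((qend (e, true) == a) && (qend (e, false) == b))
                  || ((qend (e, true) == b) && (qend (e, false) == a))].

Lemma qrel_dart d : qrel (qend d) (qend (flip d)).
Proof. by apply/existsP; exists d.1; case: d => e []; rewrite !eqxx ?orbT. Qed.

Lemma qrel_sym : symmetric qrel.
Proof. by move=> a b; apply/existsP/existsP => -[e h]; exists e; rewrite orbC. Qed.

Lemma qconnected u v : connect qrel u v.
Proof.
suff H w : connect qrel qbase w.
  by apply: connect_trans (H v); rewrite (sym_connect_sym qrel_sym).
have /mapP[x xF ew] := valP w; have [p [xp ex pF]] := Fpath xF.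
elim/last_ind: p x w xF xp ex ew pF => [|p y IH] x w xF xp ex ew pF.
  by have -> : w = qbase; [apply: val_inj; rewrite ew -ex|exact: connect0].
move: xp ex; rewrite rcons_path last_rcons => /andP[xp lx] yx; subst y.
have lF : last x0 p \in F.
  have := mem_last x0 p; rewrite inE => /predU1P[->//|lp].
  by apply: pF; rewrite mem_rcons inE lp orbT.
have [d [g [e1 e2]]] := qdart_exists lF xF lx.
have dw : qend (flip d) = w.
  by apply: val_inj; rewrite val_qend ew -e2 orep_act.
apply: connect_trans (IH (last x0 p) (qend d) lF xp erefl _ _) _.
- by rewrite val_qend -e1 orep_act.
- by move=> z zp; apply: pF; rewrite mem_rcons inE zp orbT.
by rewrite -dw; apply/connect1/qrel_dart.
Qed.

Definition quotient_graph : graph_of_groups :=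
  @GraphOfGroups qvert qedge (fun e => qend (e, true)) (fun e => qend (e, false))
    qvgroup qegroup (fun e => @qhom (e, true)) (fun e => @qhom (e, false))
    (fun e => @qmap_inj (e, true)) (fun e => @qmap_inj (e, false))
    (inhabits qbase) qconnected.

Local Notation Y := quotient_graph.
Implicit Types (w : seq (letter Y)) (d : gedge Y * bool).

Lemma dsrcE d : dsrc d = qend d.
Proof. by case: d => e []. Qed.

(** The value at a dart carries one of the two conjugations in [qmap] to the other, as the edge
    relation demands. *)
Definition letter_val (a : letter Y) : G :=
  match a with
  | inl u => val (tagged u : qvgroup (tag u))
  | inr d => (gam (qpt d))^-1 * gam (qpt (flip d))
  end.

Definition word_val w : G := foldr (fun a g => letter_val a * g) 1 w.

Lemma word_val_cat w w' : word_val (w ++ w') = word_val w * word_val w'.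
Proof. by elim: w => [|a w IH] /=; rewrite ?mul1g // IH mulgA. Qed.

Lemma word_val1 a : word_val [:: a] = letter_val a.
Proof. exact: mulg1. Qed.

Lemma flipK d : flip (flip d) = d.
Proof. by case: d => e b; rewrite /flip /= negbK. Qed.

Lemma val_dmap d (a : egroup d.1) :
  val (dmap a : qvgroup (dsrc d)) =
  (gam (qpt d))^-1 * (val (a : qegroup d.1) * gam (qpt d)).
Proof. by case: d a => e []. Qed.

Lemma word_val_eq w w' : word_eq w w' -> word_val w = word_val w'.
Proof.
elim=> {w w'} //.
- by move=> w w' w'' _ -> _.
- by move=> u u' w w' _ e _ e'; rewrite !word_val_cat e e'.
- by move=> v; rewrite /= mulg1.
- by move=> v x y; rewrite /= !mulg1.
- by move=> e b; rewrite /= -[(e, ~~ b)]/(flip (e, b)) flipK !gnorm.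
by move=> e a; rewrite /= /qpt /= !gnorm.
Qed.

(** For a walk [w] from the base to [v], this is the end of its lift to X starting at [x0]. *)
Definition wpt w (v : gvert Y) : X := act (word_val w) (val (v : qvert)).

Lemma stab_val (v : gvert Y) (g : vgroup v) :
  act (val (g : qvgroup v)) (val (v : qvert)) = val (v : qvert).
Proof. exact: set_mem (valP (g : qvgroup v)). Qed.

Lemma stab_val_eq (v : gvert Y) (g : vgroup v) x :
  val (v : qvert) = x -> act (val (g : qvgroup v)) x = x.
Proof. by move=> <-; exact: stab_val. Qed.

Lemma wpt_vlet w (v : gvert Y) (g : vgroup v) : wpt (w ++ [:: vlet g]) v = wpt w v.
Proof. by rewrite /wpt word_val_cat word_val1 actM stab_val. Qed.

(* The element carrying the chosen lift of the edge [d] to the edge of X along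
   which [wpt] moves when [inr d] is appended to [w]. *)
Definition wframe w d : G := word_val w * (gam (qpt d))^-1.

Lemma wframe_src w d : act (wframe w d) (qpt d) = wpt w (dsrc d).
Proof. by rewrite /wframe /wpt actM ofactorVP // dsrcE val_qend. Qed.

Lemma wframe_tgt w d :
  act (wframe w d) (qpt (flip d)) = wpt (w ++ [:: inr d]) (dsrc (dinv d)).
Proof.
rewrite /wpt word_val_cat word_val1 /= mulgA [RHS]actM dsrcE val_qend.
congr (act _ _); exact: esym (ofactorP act1 actM (qpt (flip d))).
Qed.

Lemma wpt_adj w d : adj (wpt w (dsrc d)) (wpt (w ++ [:: inr d]) (dsrc (dinv d))).
Proof. by rewrite -wframe_src -wframe_tgt act_adj // qpt_adj. Qed.

Lemma stab_edge (d : qedge * bool) (A : G) :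
  act A (qpt d) = qpt d -> act A (qpt (flip d)) = qpt (flip d) ->
  A \in stab act2 (val d.1).
Proof.
move=> Ax Ay; apply/mem_set; rewrite /stab /= /act2.
move: Ax Ay; rewrite /qpt /=; case: (val d.1) => z1 z2 /=.
by case: d.2 => /= -> ->.
Qed.

(** * Injectivity of the morphism to G *)

Section Injectivity.
Variable h : X -> nat.
Hypotheses (h0 : h x0 = 0%N)
  (hS : forall x y, adj x y -> h y = (h x).+1 \/ h x = (h y).+1)
  (h_uniq : forall x y z, adj x y -> adj x z -> (h y < h x)%N -> (h z < h x)%N ->
     y = z).

(** These words play the role of reduced words: their lifts climb at every dart. A vertex letter
    ends each of them, ready to absorb a further one. *)
Inductive ascending : gvert Y -> seq (letter Y) -> Prop :=
| asc_vlet (g : vgroup (qbase : gvert Y)) : ascending qbase [:: vlet g]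
| asc_dart w d (g : vgroup (dsrc (dinv d))) :
    ascending (dsrc d) w ->
    h (wpt (w ++ [:: inr d]) (dsrc (dinv d))) = (h (wpt w (dsrc d))).+1 ->
    ascending (dsrc (dinv d)) (w ++ [:: inr d; vlet g]).

Lemma ascending_vlet v w (g : vgroup v) : ascending v w ->
  exists w', ascending v w' /\ word_eq (w ++ [:: vlet g]) w'.
Proof.
move=> asc; case: asc g => [x g|{}w d x asc hw g].
  by exists [:: vlet (x * g)]; split; [exact: asc_vlet|exact: we_mul].
exists (w ++ [:: inr d; vlet (x * g)]); split; first exact: asc_dart.
by rewrite -catA; apply: we_catl; apply: we_cons; apply: we_mul.
Qed.

(** Colours determine the direction of a dart, and the orbit of any lift determines its edge. *)
Lemma flip_same d d1 w w1 (k : G) :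
  act k (qpt d1) = act (wframe w d) (qpt (flip d)) ->
  act k (qpt (flip d1)) = act (wframe w d) (qpt d) -> d = dinv d1.
Proof.
case: d d1 => e b [e1 b1] k1 k2.
have eb : b = ~~ b1.
  have := congr1 c k1; rewrite !c_act !qpt_color /= => ->.
  by rewrite negbK.
subst b; rewrite /dinv /=; congr (_, _); apply: val_inj.
have mem_rep2 (f : qedge) : rep2 (val f) = val f.
  by have /mapP[p _ ->] := valP f; exact: (orep_orep act21 act2M).
rewrite -mem_rep2 -[RHS]mem_rep2.
rewrite -(orep_act act21 act2M (wframe w (e, ~~ b1)) (val e)).
rewrite -[RHS](orep_act act21 act2M k (val e1)).
by congr orep; rewrite /act2; case: b1 k1 k2 => /= k1 k2; congr (_, _); rewrite ?k1 ?k2.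
Qed.

(* If the last step goes down, it goes back along the edge by which [w] arrived,
   and the last vertex letter of [w] lies in the edge group. *)
Lemma ascending_dart w d : ascending (dsrc d) w ->
  exists w', ascending (dsrc (dinv d)) w' /\ word_eq (w ++ [:: inr d]) w'.
Proof.
move=> asc; have [up|down] := hS (wpt_adj w d).
  exists (w ++ [:: inr d; vlet (1 : vgroup (dsrc (dinv d)))]).
  split; first exact: asc_dart.
  apply: we_catl; exact: (we_catl [:: inr d] (we_sym (we_one _))).
(* The index becomes a variable so that [asc] can be analysed by cases. *)
have [u eu] : exists u, u = dsrc d by exists (dsrc d).
rewrite -eu in asc.
have {}down : h (wpt w u) = (h (wpt (w ++ [:: inr d]) (dsrc (dinv d)))).+1.
  by rewrite eu.
case: asc eu down => [g|{}w d1 g asc hw] eu.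
  (* Without a dart the lift is still at [x0], and nothing lies below height 0. *)
  by rewrite -[[:: vlet g]]cat0s wpt_vlet /wpt /= act1 h0.
have catE : w ++ [:: inr d1; vlet g] = (w ++ [:: inr d1]) ++ [:: vlet g].
  by rewrite -catA.
set w' := w ++ [:: inr d1; vlet g]; set q := wpt (w' ++ _) _.
have ep : wpt w' (dsrc d) = wpt (w ++ [:: inr d1]) (dsrc (dinv d1)).
  by rewrite -eu /w' catE wpt_vlet.
rewrite {1}/w' catE wpt_vlet => down.
have qp : q = wpt w (dsrc d1).
  apply: (h_uniq (x := wpt (w ++ [:: inr d1]) (dsrc (dinv d1)))).
  - by rewrite -ep; apply: wpt_adj.
  - by rewrite adjC; apply: wpt_adj.
  - by rewrite down.
  - by rewrite hw.
have dd1 : d = dinv d1.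
  apply: (@flip_same d d1 w' w (wframe w d1)).
    by rewrite wframe_src wframe_tgt.
  by rewrite wframe_src wframe_tgt ep.
subst d; rewrite dinvK; clear eu ep down.
set y := qpt (flip d1).
(* [A] is the letter [g] conjugated back to the chosen lift of [d1]. It fixes both ends of that
   lift, so it belongs to the edge group. *)
pose A : G := gam y * (val (g : qvgroup (dsrc (dinv d1))) * (gam y)^-1).
have Ay : act A y = y.
  rewrite /A !actM ofactorVP //.
  rewrite stab_val_eq; first exact: ofactorP.
  by rewrite dsrcE val_qend.
have Ax : act A (qpt d1) = qpt d1.
  apply: (can_inj (actK act1 actM (wframe w d1))).
  rewrite wframe_src -qp /q -wframe_tgt -actM -[dinv d1]/(flip d1) flipK.
  congr act; rewrite /wframe /w' !word_val_cat /= /A -[dinv d1]/(flip d1) -/y.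
  by rewrite !gnorm.
have Ad : A \in stab act2 (val d1.1) := stab_edge Ax Ay.
pose a : qegroup d1.1 := exist (fun x : G => x \in stab act2 (val d1.1)) A Ad.
have ga : g = dmap (d := dinv d1) (a : egroup d1.1).
  apply: val_inj; apply: etrans (esym (val_dmap (d := dinv d1) (a : egroup d1.1))).
  by rewrite -[qpt (dinv d1)]/y /= /A !gnorm.
have [w'' [asc' ww'']] := ascending_vlet (dmap (d := d1) (a : egroup d1.1)) asc.
exists w''; split=> //; apply: we_trans ww''.
rewrite /w' -catA; apply: we_catl; rewrite ga.
apply: (we_trans (w' :=
  [:: vlet (dmap (d := d1) (a : egroup d1.1)); inr d1; inr (dinv d1)])).
  exact: (we_catr [:: inr (dinv d1)] (we_sym (we_dart _))).
apply: we_cons; case: (d1) => e b; exact: we_inv.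
Qed.

Lemma walk_ascending v w : walk (qbase : gvert Y) v w ->
  exists w', ascending v w' /\ word_eq w w'.
Proof.
elim/last_ind: w v => [|w a IH] v.
  move=> /= /eqP <-; exists [:: vlet (1 : vgroup (qbase : gvert Y))].
  by split; [exact: asc_vlet|exact/we_sym/we_one].
rewrite -cats1 walk_rcons => /andP[/IH [w1 [asc ww1]] /eqP <-].
have [w2 [asc2 ww2]] : exists w', ascending (letter_tgt a) w' /\
    word_eq (w1 ++ [:: a]) w'.
  case: a asc => [[u g]|d] asc; first exact: ascending_vlet.
  by rewrite (dtgtE d); apply: ascending_dart.
by exists w2; split=> //; apply: we_trans (we_catr _ ww1) ww2.
Qed.

Lemma ascending_root v w : ascending v w -> h (wpt w v) = 0%N ->
  exists g : vgroup (qbase : gvert Y), w = [:: vlet g].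
Proof.
case=> [g _|{}w d g _ hw]; first by exists g.
have -> : w ++ [:: inr d; vlet g] = (w ++ [:: inr d]) ++ [:: vlet g].
  by rewrite -catA.
by rewrite wpt_vlet hw.
Qed.

Lemma word_val_inj w : walk (qbase : gvert Y) (qbase : gvert Y) w ->
  word_val w = 1 -> word_eq w [::].
Proof.
move=> /walk_ascending[w' [asc ww']]; rewrite (word_val_eq ww') => w1.
apply: we_trans ww' _.
have [|g e] := ascending_root asc; first by rewrite /wpt w1 act1.
move: w1; rewrite e word_val1 => g1; have -> : g = 1 by exact: val_inj.
exact: we_one.
Qed.
End Injectivity.

Lemma dart_walk d (g : vgroup (dsrc d)) :
  walk (dsrc d) (dsrc (dinv d)) [:: vlet g; inr d].
Proof. by case: d g => e [] g; rewrite /= !eqxx. Qed.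

(** * Surjectivity of the morphism to G *)

Section Surjectivity.
Variable S : seq G.
Hypotheses (gen : forall K : set G, subgroup K -> [set` S] `<=` K -> K = [set: G])
  (S_F : forall s, s \in S -> act s x0 \in F).

Lemma path_word p : path adj x0 p -> {subset p <= F} ->
  exists (v : gvert Y) w, [/\ walk (qbase : gvert Y) v w, wpt w v = last x0 p &
    val (v : qvert) = rep (last x0 p)].
Proof.
elim/last_ind: p => [|p y IH] xp pF.
  exists (qbase : gvert Y), [::]; split=> //=; rewrite /wpt ?act1 //.
move: xp; rewrite rcons_path last_rcons => /andP[xp ly].
have lF : last x0 p \in F.
  have := mem_last x0 p; rewrite inE => /predU1P[->//|lp].
  by apply: pF; rewrite mem_rcons inE lp orbT.
have yF : y \in F by apply: pF; rewrite mem_rcons mem_head.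
have [|v [w [wv wp ev]]] := IH xp.
  by move=> z zp; apply: pF; rewrite mem_rcons inE zp orbT.
have [d [g [e1 e2]]] : exists (d : gedge Y * bool) g,
    act g (qpt d) = last x0 p /\ act g (qpt (flip d)) = y := qdart_exists lF yF ly.
have dv : dsrc d = v.
  by apply: val_inj; rewrite dsrcE val_qend ev -e1 orep_act.
(* The letter [k] fixes the vertex where the lift must turn, and directs the lift of [d] along the
   next edge of the path. *)
subst v; pose k := (word_val w)^-1 * (g * gam (qpt d)).
have kS : k \in stab act (val (dsrc d : qvert)).
  apply/mem_set; rewrite /stab /= {1}dsrcE val_qend /k 2!actM ofactorP // e1 -wp.
  by rewrite /wpt actK.
pose kv : qvgroup (dsrc d) :=
  exist (fun x : G => x \in stab act (val (dsrc d : qvert))) k kS.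
exists (dsrc (dinv d)), (w ++ [:: vlet (kv : vgroup (dsrc d)); inr d]).
split.
- by apply: walk_cat wv _; exact: dart_walk.
- rewrite /wpt word_val_cat /= mulg1 /k !gnorm.
  rewrite dsrcE val_qend actM -[dinv d]/(flip d) ofactorP //.
by rewrite dsrcE val_qend -e2 orep_act.
Qed.

Lemma word_val_surj g :
  exists w, walk (qbase : gvert Y) (qbase : gvert Y) w /\ word_val w = g.
Proof.
pose K := [set g | exists w,
  walk (qbase : gvert Y) (qbase : gvert Y) w /\ word_val w = g].
suff KT : K = [set: G] by have : K g by rewrite KT.
have word_valV w : word_val (winv w) = (word_val w)^-1.
  apply: (mulgI (word_val w)); rewrite -word_val_cat mulgV.
  exact: word_val_eq (winvV w).
apply: gen.
  apply: subgroupI => [|_ _ [w [ww <-]] [u [uu <-]]|_ [w [ww <-]]].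
  - by exists [::]; rewrite /= eqxx.
  - by exists (w ++ u); split; [exact: walk_cat ww uu|exact: word_val_cat].
  - by exists (winv w); split; [exact: walk_winv|].
move=> s sS; have [p [xp ep pF]] := Fpath (S_F sS).
have [v [w [wv wp ev]]] := path_word xp pF.
have vb : v = qbase by apply: val_inj; rewrite ev ep orep_act // rep_x0.
(* [w] and [s] move [x0] to the same point, so they differ by an element of the base vertex
   group. *)
subst v; pose k := (word_val w)^-1 * s.
have kS : k \in stab act (val qbase).
  apply/mem_set; rewrite /stab /= /k actM -[X in act s X]/x0 -ep -wp /wpt actK //.
pose kv : qvgroup qbase := exist (fun x : G => x \in stab act (val qbase)) k kS.
exists (w ++ [:: vlet (kv : vgroup (qbase : gvert Y))]); split.
  by apply: walk_cat wv _; rewrite /= !eqxx.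
by rewrite word_val_cat word_val1 /= mulVKg.
Qed.
End Surjectivity.

Lemma quotient_graph_pi1 (S : seq G) :
  (forall K : set G, subgroup K -> [set` S] `<=` K -> K = [set: G]) ->
  (forall s, s \in S -> act s x0 \in F) ->
  (exists h : X -> nat, [/\ h x0 = 0%N,
     forall x y, adj x y -> h y = (h x).+1 \/ h x = (h y).+1 &
     forall x y z, adj x y -> adj x z -> (h y < h x)%N -> (h z < h x)%N -> y = z]) ->
  isomorphic G (pi1 (qbase : gvert Y)).
Proof.
move=> gen S_F [h [h0 hS h_uniq]].
pose f (p : pi1 (qbase : gvert Y)) : G := word_val (val (repr p)).
have f_pi (p : loop (qbase : gvert Y)) :
    f (\pi_(pi1 (qbase : gvert Y)) p) = word_val (val p).
  exact: word_val_eq (pi1_reprP p).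
have fM : {morph f : p q / p * q}.
  by move=> p q; rewrite [p * q]/(pi1_mul p q) f_pi /= word_val_cat.
have f1 p : f p = 1 -> p = 1.
  move=> /(word_val_inj h0 hS h_uniq (valP (repr p))) e.
  by rewrite -[p]reprK; apply/pi1P.
pose m := @isMultiplicative.Build (pi1 (qbase : gvert Y)) G f fM.
pose fm : {multiplicative pi1 (qbase : gvert Y) -> G} := HB.pack f m.
have f_surj g : exists p, f p = g.
  have [w [ww <-]] := word_val_surj gen S_F g.
  by exists (\pi_(pi1 (qbase : gvert Y)) (exist _ w ww : loop _)); rewrite f_pi.
have [k kP] := choice f_surj.
have fI : injective f.
  move=> p q pq; apply/eqP; rewrite -divg_eq1; apply/eqP/f1.
  by rewrite fM -[f q^-1]/(fm q^-1) morphV /= pq mulgV.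
have kf : cancel k f by [].
have fk : cancel f k by move=> p; apply: fI; rewrite kP.
have kM : {morph k : x y / x * y} by move=> x y; apply: fI; rewrite fM !kP.
pose mk := @isMultiplicative.Build G (pi1 (qbase : gvert Y)) k kM.
pose km : {multiplicative G -> pi1 (qbase : gvert Y)} := HB.pack k mk.
by exists km; exists f.
Qed.

(** Up to conjugation, the edge group is the stabiliser of the far end of an edge within the
    stabiliser of its near end, so its index is at most the number of neighbours. *)
Lemma quotient_graph_finite_index :
  (forall x, finite_set [set y | adj x y]) -> finite_index_edges Y.
Proof.
move=> adjF; suff H d : finite_index [set: vgroup (dsrc d)] (range (@dmap _ d)).
  by move=> e; split; [exact: (H (e, true))|exact: (H (e, false))].
have /finite_set_leP[n an] := adjF (qpt d).
apply/finite_set_leP; exists n.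
pose phi (g : qvgroup (dsrc d)) : X :=
  act (gam (qpt d) * (val g * (gam (qpt d))^-1)) (qpt (flip d)).
have rangeP (g : qvgroup (dsrc d)) :
    act (gam (qpt d) * (val g * (gam (qpt d))^-1)) (qpt (flip d)) = qpt (flip d) ->
    range (@dmap _ d) g.
  set A := _ * _ => Ay.
  have Ax : act A (qpt d) = qpt d.
    rewrite /A !actM ofactorVP // stab_val_eq ?ofactorP //.
    by rewrite dsrcE val_qend.
  have Ad : A \in stab act2 (val d.1) := stab_edge Ax Ay.
  pose a : qegroup d.1 := exist (fun x : G => x \in stab act2 (val d.1)) A Ad.
  exists (a : egroup d.1) => //; apply: val_inj.
  by apply: etrans (val_dmap (a : egroup d.1)) _; rewrite /= /A !gnorm.
apply: (@index_le_orbit _ X phi [set y | adj (qpt d) y]) => //.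
- exact: dmap_range_subgroup.
- move=> g k _ _ /(congr1 (act (gam (qpt d) * ((val g)^-1 * (gam (qpt d))^-1)))).
  rewrite /phi -!actM !gnorm act1 => e; apply: rangeP.
  by rewrite [in RHS]e sub_valM // !gnorm.
move=> g _; rewrite /phi /=.
have {1}<- : act (gam (qpt d) * (val g * (gam (qpt d))^-1)) (qpt d) = qpt d.
  rewrite !actM ofactorVP // stab_val_eq ?ofactorP //.
  by rewrite dsrcE val_qend.
by apply: act_adj; apply: qpt_adj.
Qed.
End QuotientGraph.

(** * Chains of stabilisers *)

Lemma logn_oddM j k : logn 2 (2 ^ j * k.*2.+1) = j.
Proof.
rewrite lognM ?expn_gt0 // pfactorK // logn_coprime ?addn0 //.
by rewrite coprime2n /= odd_double.
Qed.

Section Enumeration.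
Variables (T : tree) (t : T).
Hypothesis T_fin : forall x : T, finite_set (neighbours x).

Lemma neighbour_list : exists N : T -> seq T, forall x y, (y \in N x) = adj x y.
Proof.
suff /choice[N NP] x : exists s : seq T, forall y, (y \in s) = adj x y by exists N.
have /finite_seqP[s xs] := T_fin x; exists s => y.
apply/idP/idP => h; first by have : [set` s] y by []; rewrite -xs.
by have : neighbours x y by []; rewrite xs.
Qed.

(* An integer i > 0 is written 2 ^ j * (2 k + 1), so that j < i; the i-th vertex
   is then the k-th neighbour of the j-th one. *)
Lemma vertex_enumeration : exists e : nat -> T,
  [/\ e 0 = t,
      forall i, (0 < i)%N -> exists j, (j < i)%N /\ (e i = e j \/ adj (e j) (e i)) &
      forall x, exists i, e i = x].
Proof.
have [N NP] := neighbour_list.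
pose nbr x k := nth x (N x) k.
(* [f] is fuel, as the recursion jumps from i to [logn 2 i]. *)
pose fix ef (f i : nat) {struct f} : T :=
  if f is f'.+1 then
    if i == 0%N then t else nbr (ef f' (logn 2 i)) (i %/ 2 ^ logn 2 i)./2
  else t.
have ef_fuel f f' i : (i < f)%N -> (i < f')%N -> ef f i = ef f' i.
  elim: f f' i => // f IH [|f'] // i; rewrite !ltnS /= => fi fi'.
  have [//|i0] := posnP i; have li : (logn 2 i < i)%N by exact: ltn_logl.
  by rewrite (IH f') //; apply: leq_trans li _.
pose e i := ef i.+1 i.
have eS i : (0 < i)%N -> e i = nbr (e (logn 2 i)) (i %/ 2 ^ logn 2 i)./2.
  move=> i0; rewrite /e [LHS]/= gtn_eqF //; congr nbr; apply: ef_fuel => //.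
  exact: ltn_logl.
exists e; split=> // [i i0|x].
  exists (logn 2 i); split; first exact: ltn_logl.
  rewrite eS // /nbr; set z := e _; set k := _./2.
  (* When k is out of range, the default of [nth] repeats the j-th vertex. *)
  have [kz|zk] := ltnP k (size (N z)); last by left; rewrite nth_default.
  by right; rewrite -NP mem_nth.
have [p [tp <-]] := tree_connected t x.
elim/last_ind: p tp => [|p y IH]; first by exists 0%N.
rewrite rcons_path last_rcons => /andP[/IH[j ej] ly].
pose k := index y (N (e j)); exists (2 ^ j * k.*2.+1)%N.
rewrite eS; last by rewrite muln_gt0 expn_gt0.
rewrite logn_oddM mulKn ?expn_gt0 // -[k.*2.+1./2]/(uphalf k.*2) uphalf_double.
by rewrite /nbr /k nth_index // NP ej.
Qed.
End Enumeration.

Lemma index_le_finite (G : groupType) (H K : set G) n :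
  index_le H K n -> finite_index H K.
Proof. by move=> h; apply/finite_set_leP; exists n. Qed.

Section StabilizerChain.
Variables (G : groupType) (T : tree) (a : tree_action G T) (d : nat).
Hypotheses (fa : forall g, (forall x, a g x = x) -> g = 1)
  (Td : forall x : T, neighbours x #<= `I_d).

(* In an enumeration in which every vertex is adjacent to an earlier one, the
   pointwise stabiliser of the first i vertices moves the i-th one to at most d
   places. *)
Lemma stabilizer_chain (A : set T) (x y : T)
  (sA : subgroup (stab (fun g (B : set T) => a g @` B) A)) :
  A = [set x; y] -> has_index_chain (subgroup_type sA) d.+2.
Proof.
move=> Axy; have [|e [e0 eS e_surj]] := @vertex_enumeration T x.
  by move=> z; apply/finite_set_leP; exists d.
pose H : groupType := subgroup_type sA.
pose K i : set H := [set g | forall j, (j < i)%N -> a (val g) (e j) = e j].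
have sK i : subgroup (K i).
  apply: subgroupI => [j _|g k gK kK j ji|g gK j ji].
  - exact: tact1.
  - by rewrite sub_valM tactM kK // gK.
  - by rewrite -{1}(gK j ji) tactK.
have KS i : K i.+1 `<=` K i by move=> g gK j ji; apply: gK; exact: ltnW.
have KT : K 0%N = [set: H] by apply/predeqP.
have Kn i : index_le (K i) (K i.+1) d.+2.
  (* At stage 0 the group preserves {x, y}, so x has at most 2 images. Later images are [e j] or one
     of its at most d neighbours. The bound d + 2 covers both cases and is at least 2. *)
  pose s : set T :=
    if i is _.+1 then [set z | exists g, K i g /\ z = a (val g) (e i)] else A.
  apply: (@index_le_orbit _ _ (fun g : H => a (val g) (e i)) s) => //.
  - move=> g k gK kK gk j; rewrite ltnS leq_eqVlt => /predU1P[->|ji].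
      by rewrite sub_valM tactM -gk -tactM mulVg tact1.
    rewrite sub_valM tactM kK //.
    by rewrite -{1}(gK j ji) tactK.
  - move=> g gK; rewrite /s; case: i gK {s} => [|i] gK; last by exists g.
    have gA : a (val g) @` A = A := set_mem (valP g).
    have : (a (val g) @` A) (a (val g) (e 0)) by exists (e 0) => //; rewrite e0 Axy; left.
    by rewrite gA.
  rewrite /s; case: i {s} => [|i].
    apply/card_le_seqP; exists [:: x; y] => // z.
    by rewrite Axy /= !inE => -[->|->]; rewrite eqxx ?orbT.
  have [j [ji ej]] := eS i.+1 isT.
  have /card_le_seqP[s sd es] := Td (e j).
  apply/card_le_seqP; exists (e j :: s); first by rewrite /= !ltnS ltnW.
  move=> _ [g [gK ->]]; rewrite /= inE.
  case: ej => [->|ej]; first by rewrite (gK j ji) eqxx.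
  by apply/orP; right; apply: es; rewrite /neighbours /= -{1}(gK j ji) tact_adj.
exists K; split=> //; split=> //; split; last (split=> //; split=> //).
- elim=> [|i IH].
    rewrite KT; apply: (@index_le_finite _ _ _ 1).
    apply/card_le_seqP; exists [:: [set: H]] => // _ [g _ <-].
    rewrite /= inE; apply/eqP/predeqP => z; split=> // _; apply/lcosetP => //.
  by apply: finite_index_trans (sK i) (sK i.+1) IH _; apply: index_le_finite (Kn i).
apply/predeqP => g; split=> [gK|->]; last by move=> i _ j _; exact: tact1.
apply: val_inj; apply: fa => z; have [i <-] := e_surj z.
exact: (gK i.+1 I i (ltnSn i)).
Qed.
End StabilizerChain.

(** * Subdivision *)

Lemma set2_eq (T : Type) (x y u v : T) :
  [set x; y] = [set u; v] -> (x = u /\ y = v) \/ (x = v /\ y = u).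
Proof.
move=> e; have in2 z : (z = x \/ z = y) <-> (z = u \/ z = v).
  by have /predeqP /(_ z) := e.
have [[xx _] [_ yy]] := (in2 x, in2 y).
have [[uu _] [_ vv]] := ((iff_sym (in2 u)), (iff_sym (in2 v))).
have := proj1 (in2 x) (or_introl erefl); have := proj1 (in2 y) (or_intror erefl).
have := proj2 (in2 u) (or_introl erefl); have := proj2 (in2 v) (or_intror erefl).
by intuition (subst; auto).
Qed.

(* The barycentric subdivision, on which every automorphism acts without
   inversion.  Its vertices are the sets [set x] and [set x; y] with x adjacent
   to y; all other sets are isolated points. *)
Section Subdivision.
Variable T : tree.
Implicit Types (A B C : set T) (x y : T).

Definition sub_incl A B : Prop :=
  exists x y, [/\ adj x y, A = [set x] & B = [set x; y]].

Definition sub_adj A B : bool := `[< sub_incl A B \/ sub_incl B A >].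

Definition is_point A : bool := `[< exists x, A = [set x] >].

Lemma sub_adj_sym : symmetric sub_adj.
Proof. by move=> A B; apply/asboolP/asboolP => -[]; [right|left|right|left]. Qed.

Lemma point_inj x u : [set x] = [set u] -> x = u.
Proof. by move=> e; have : [set x] x by []; rewrite e. Qed.

Lemma point_pair x u v : [set x] = [set u; v] -> u = v.
Proof. by move=> e; case: (@set2_eq _ x x u v); rewrite ?setUid // => -[<- <-]. Qed.

Lemma sub_adj_point A B : sub_adj A B -> is_point B = ~~ is_point A.
Proof.
have H C D : sub_incl C D -> is_point C /\ ~~ is_point D.
  move=> [x [y [xy -> ->]]]; split; apply/asboolP; first by exists x.
  by move=> [z /esym/point_pair e]; rewrite e adj_irr in xy.
by case/asboolP => /H [p np]; rewrite p ?np // (negbTE np).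
Qed.

Section Action.
Variables (G : groupType) (a : tree_action G T).

Definition sub_act g A : set T := a g @` A.

Lemma sub_act1 A : sub_act 1 A = A.
Proof.
by rewrite /sub_act (_ : a 1 = id) ?image_id //; apply/funext => x; exact: tact1.
Qed.

Lemma sub_actM g h A : sub_act (g * h) A = sub_act g (sub_act h A).
Proof.
rewrite /sub_act image_comp; congr image; apply/funext => x; exact: tactM.
Qed.

Lemma sub_act_point g x : sub_act g [set x] = [set a g x].
Proof. exact: image_set1. Qed.

Lemma sub_act_pair g x y : sub_act g [set x; y] = [set a g x; a g y].
Proof. by rewrite /sub_act image_setU !image_set1. Qed.

Lemma sub_act_adj g A B : sub_adj A B -> sub_adj (sub_act g A) (sub_act g B).
Proof.
have H C D : sub_incl C D -> sub_incl (sub_act g C) (sub_act g D).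
  move=> [x [y [xy -> ->]]]; exists (a g x), (a g y).
  by rewrite sub_act_point sub_act_pair tact_adj.
by case/asboolP => /H h; apply/asboolP; [left|right].
Qed.

Lemma sub_act_is_point g A : is_point (sub_act g A) = is_point A.
Proof.
have H k B : is_point B -> is_point (sub_act k B).
  by move=> /asboolP[x ->]; rewrite sub_act_point; apply/asboolP; exists (a k x).
apply/idP/idP; last exact: H.
by move/(H g^-1); rewrite -sub_actM mulVg sub_act1.
Qed.
End Action.

Lemma sub_adj_finite A :
  (forall x, finite_set (neighbours x)) -> finite_set [set B | sub_adj A B].
Proof.
move=> fin; have [[x ->]|nA] := pselect (exists x, A = [set x]).
  apply: sub_finite_set (finite_image (fun y => [set x; y]) (fin x)) => B.
  case/asboolP => -[u [v [uv]]]; last by move=> _ /point_pair e; rewrite e adj_irr in uv.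
  by move=> /point_inj xu ->; subst u; exists v.
have [[[x y] /= Axy]|n2] := pselect (exists p : T * T, A = [set p.1; p.2]); last first.
  apply: sub_finite_set (finite_set0 _) => B /asboolP[] [u [v [_ e1 e2]]].
    by case: nA; exists u.
  by case: n2; exists (u, v).
rewrite Axy.
apply: sub_finite_set (finite_set2 [set x] [set y]) => B /asboolP[] [u [v [uv e1 e2]]].
  by move: e1 => /esym/point_pair e; case: nA; exists x; rewrite Axy -e setUid.
by rewrite e1; case: (set2_eq e2) => -[-> ->]; [left|right].
Qed.

Variable z : T.

(** This is the distance from [[set z]] in the subdivision; a point counts as a pair with equal ends
    and gets twice its depth. *)
Definition sub_depth A : nat :=
  let p := xget (z, z) [set p | A = [set p.1; p.2]] in depth z p.1 + depth z p.2.

Lemma sub_depth_pair x y : sub_depth [set x; y] = depth z x + depth z y.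
Proof.
rewrite /sub_depth; case: xgetP => [[u v] _ /= e|/(_ (x, y)) []//].
by case: (set2_eq e) => -[-> ->] //; exact: addnC.
Qed.

Lemma sub_depth_point x : sub_depth [set x] = (depth z x).*2.
Proof. by rewrite -[[set x]]setUid sub_depth_pair addnn. Qed.

Lemma sub_depth_step A B :
  sub_adj A B -> sub_depth B = (sub_depth A).+1 \/ sub_depth A = (sub_depth B).+1.
Proof.
by case/asboolP => -[x [y [/(depth_step z) xy -> ->]]];
  rewrite sub_depth_point sub_depth_pair; lia.
Qed.

Lemma sub_depth_uniq A B C : sub_adj A B -> sub_adj A C ->
  (sub_depth B < sub_depth A)%N -> (sub_depth C < sub_depth A)%N -> B = C.
Proof.
case/asboolP => -[x [y [xy e1 e2]]]; case/asboolP => -[u [v [uv e3 e4]]].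
- rewrite e2 e4 !sub_depth_pair e1 sub_depth_point => yx vu.
  have xu : x = u by apply: point_inj; rewrite -e1 -e3.
  subst u.
  by congr [set _; _]; apply: (@depth_le_uniq T z x) => //; lia.
- by move: uv; rewrite (point_pair (etrans (esym e1) e4)) adj_irr.
- by move: xy; rewrite (point_pair (etrans (esym e3) e2)) adj_irr.
rewrite e1 e3; have [[-> //]|[_ yu]] := set2_eq (etrans (esym e2) e4).
by rewrite e2 sub_depth_pair !sub_depth_point -yu; lia.
Qed.

Lemma sub_path x p : path (@adj T) x p ->
  exists P, path sub_adj [set x] P /\ last [set x] P = [set last x p].
Proof.
elim: p x => [|y p IH] x /=; first by exists [::].
case/andP=> xy /IH[P [yP lP]]; exists [:: [set x; y], [set y] & P]; split=> //=.
rewrite yP andbT; apply/andP; split; apply/asboolP; [left|right].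
  by exists x, y.
by exists y, x; rewrite adj_sym xy setUC.
Qed.
End Subdivision.

(** * From an action on a bounded tree to a graph of groups *)

Lemma bounded_embeds_graph (G : groupType) (T : tree) :
  finitely_generated G -> uniformly_bounded T -> embeds G (tree_aut T) ->
  exists (Y : graph_of_groups) (v0 : gvert Y),
    [/\ finite_index_edges Y,
        forall v : gvert Y, exists n : nat, (2 <= n)%N /\ has_index_chain (vgroup v) n &
        isomorphic G (pi1 v0)].
Proof.
move=> [S gen] [d Td] /embeds_action[a fa].
have T_fin (x : T) : finite_set (neighbours x) by apply/finite_set_leP; exists d.
have [t0] := tree_nonempty T.
pose rep := orep (sub_act a).
have act1 := sub_act1 a; have actM := sub_actM a.
have [g0 rep0] := orepP act1 actM [set t0].
(* The base vertex must be the chosen representative of its orbit, so that the base vertex group is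
   its stabiliser. *)
have [t rept] : exists t, rep [set t0] = [set t].
  exists (a g0^-1 t0); rewrite -sub_act_point -[in RHS]rep0.
  by rewrite /rep -actM mulVg act1.
have rep_t : rep [set t] = [set t] by rewrite -rept /rep orep_orep.
have /choice[P PP] s : exists P, path (@sub_adj T) [set t] P /\
    last [set t] P = sub_act a s [set t].
  have [p [tp ep]] := tree_connected t (a s t).
  by have [P [tP lP]] := sub_path tp; exists P; rewrite sub_act_point -ep.
pose F := [set t] :: flatten [seq P s | s <- S].
have F0 : [set t] \in F by exact: mem_head.
have PF s : s \in S -> {subset P s <= F}.
  move=> sS A AP; rewrite inE; apply/orP; right.
  by apply/flattenP; exists (P s) => //; exact: map_f.
have Fpath A : A \in F ->
    exists p, [/\ path (@sub_adj T) [set t] p, last [set t] p = A & {subset p <= F}].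
  rewrite inE => /predU1P[->|/flattenP[_ /mapP[s sS ->] AP]]; first by exists [::].
  have AP' : A \in [set t] :: P s by rewrite inE AP orbT.
  have [tP _] := PP s; have PsF := PF s sS.
  case/splitPl: AP' tP PsF => p1 p2 <-; rewrite cat_path => /andP[tp1 _] pF.
  by exists p1; split=> // B Bp; apply: pF; rewrite mem_cat Bp.
have S_F s : s \in S -> sub_act a s [set t] \in F.
  move=> sS; have [_ <-] := PP s; have := mem_last [set t] (P s).
  by rewrite inE => /predU1P[->//|]; apply: PF.
have shape A : A \in F -> exists x y, A = [set x; y].
  move/Fpath => [p [+ + _]]; case/lastP: p => [_ <-|p B].
    by exists t, t; rewrite setUid.
  rewrite rcons_path last_rcons => /andP[_ + <-]; case/asboolP => -[x [y [_ e1 e2]]].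
    by exists x, y.
  by exists x, x; rewrite setUid.
pose Y := @quotient_graph G _ (sub_act a) (@sub_adj T) (@is_point T) [set t] F act1 actM
  (@sub_adj_sym T) (@sub_adj_point T) rep_t F0 Fpath.
exists Y, (qbase rep_t F0); split.
- apply: quotient_graph_finite_index => [|A]; last exact: sub_adj_finite.
  exact: sub_act_adj.
- move=> v; exists d.+2; split=> //.
  have /mapP[A AF eA] := valP (v : qvert (sub_act a) F).
  have [x [y exy]] := shape A AF.
  have [g eg] := orepP act1 actM A.
  (* The vertex group stabilises the representative of the orbit of [A], which is the translate of
     [A] by the inverse of [g]. *)
  apply: (@stabilizer_chain G T a d fa Td _ (a g^-1 x) (a g^-1 y)).
  rewrite -sub_act_pair -exy eA -[A in RHS]eg.
  by rewrite -actM mulVg act1.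
apply: (quotient_graph_pi1 act1 actM (@sub_adj_sym T) (sub_act_adj a)
  (sub_act_is_point a) (@sub_adj_point T) rep_t F0 Fpath gen S_F).
exists (sub_depth t); split.
- by rewrite sub_depth_point depth_root.
- exact: sub_depth_step.
- exact: sub_depth_uniq.
Qed.

Theorem corollary3p3 (G : groupType) (hG : finitely_generated G) :
  ((exists T : tree, uniformly_bounded T /\ embeds G (tree_aut T)) <->
   (exists T : tree, regular T /\ embeds G (tree_aut T))) /\
  ((exists T : tree, regular T /\ embeds G (tree_aut T)) <->
   (exists (Y : graph_of_groups) (v0 : gvert Y),
      finite_index_edges Y /\
      (forall v : gvert Y,
         exists n : nat, (2 <= n)%N /\ has_index_chain (vgroup v) n) /\
      isomorphic G (pi1 v0))).
Proof.
have regular_bounded (T : tree) : regular T -> uniformly_bounded T.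
  by case=> d Td; exists d => x; rewrite (card_le_eql (Td x)).
split; split.
- exact: bounded_embeds_regular.
- by move=> [T [/regular_bounded Tb GT]]; exists T.
- move=> [T [/regular_bounded Tb GT]].
  have [Y [v0 [Yf Yc GY]]] := bounded_embeds_graph hG Tb GT.
  by exists Y, v0.
move=> [Y [v0 [Yf [Yc GY]]]]; apply: bounded_embeds_regular.
have [n [_ Kn]] := Yc v0; have [T [Tb eT]] := pi1_embeds_bounded Yf Kn.
by exists T; split=> //; apply: isomorphic_embeds GY eT.
Qed.
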